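(* Let $\alpha\in(0,2]$ and $\nu>0$. Let $X_1,X_2,\ldots$ be independent (not necessarily identically distributed) random variables with $\mathsf{E}X_i=0$ and $0<\sigma_i^2=\mathsf{Var}X_i<\infty$, and set $S^*_n=X_1+\ldots+X_n$, $B_n^2=\sigma_1^2+\ldots+\sigma_n^2$. Assume the Lindeberg condition: for every $\tau>0$, $$\lim_{n\to\infty}\frac{1}{B_n^2}\sum_{i=1}^n\int_{|x|\ge\tau B_n}x^2\,d\mathsf{P}(X_i<x)=0.$$ Let $N_1,N_2,\ldots$ be nonnegative integer-valued random variables such that for each $n$, $N_n$ is independent of $X_1,X_2,\ldots$, and $N_n\to\infty$ in probability (i.e. $\mathsf{P}(N_n\le m)\to0$ for every $m$). Let $S^*_{N_n}=X_1+\ldots+X_{N_n}$ (with the empty sum equal to $0$), and let $d_n>0$, $d_n\to\infty$. Then $$\frac{S^*_{N_n}}{d_n}\Longrightarrow L_{\alpha,\nu}$$ if and only if $$\frac{B^2_{N_n}}{d_n^2}\Longrightarrow 2M_{\alpha/2,\nu}.$$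
   Context: $\Longrightarrow$ denotes convergence in distribution as $n\to\infty$. $L_{\alpha,\nu}$ denotes a random variable with characteristic function $(1+|t|^{\alpha})^{-\nu}$, $t\in\mathbb{R}$. For $\delta\in(0,1]$, $\nu>0$, $M_{\delta,\nu}$ denotes a nonnegative random variable with Laplace transform $(1+s^{\delta})^{-\nu}$, $s\ge0$ (generalized Mittag-Leffler distribution). *)

(* Defs.v *)
From HB Require Import structures.
From mathcomp Require Import all_boot all_order all_algebra.
From mathcomp Require Import all_classical all_reals all_analysis.
Set Implicit Arguments. Unset Strict Implicit. Unset Printing Implicit Defensive.
Import Order.TTheory GRing.Theory Num.Theory.
Import numFieldNormedType.Exports.
Local Open Scope classical_set_scope.
Local Open Scope ring_scope.

Section defs.
Context {R : realType} {d : measure_display} {T : measurableType d}.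

Definition mutually_independent (P : probability T R) (X : nat -> T -> R) :=
  forall (s : seq nat) (A : nat -> set R), uniq s ->
    (forall i, measurable (A i)) ->
    P (\bigcap_(i in [set` s]) (X i @^-1` A i)) =
    (\prod_(i <- s) P (X i @^-1` A i))%E.

(* The integer-valued random variable M is independent of the whole
   sequence X (i.e. of sigma(X_1, X_2, ...)): checked on the generating
   pi-system of finite-dimensional cylinder events. *)
Definition indep_of_seq (P : probability T R) (M : T -> nat) (X : nat -> T -> R) :=
  forall (k : nat) (s : seq nat) (A : nat -> set R),
    (forall i, measurable (A i)) ->
    P ([set w | M w = k] `&` \bigcap_(i in [set` s]) (X i @^-1` A i)) =
    (P [set w | M w = k] * P (\bigcap_(i in [set` s]) (X i @^-1` A i)))%E.

Definition cvg_dist_scaled (P : probability T R) (Y : nat -> T -> R)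
    (mu : probability R R) (c : R) :=
  forall f : R -> R, continuous f -> (exists M : R, forall x, `|f x| <= M) ->
    (fun n => Rintegral P setT (fun w => f (Y n w))) @ \oo -->
      Rintegral mu setT (fun x => f (c * x)).

End defs.

(* mu is the law of L_{alpha,nu}: characteristic function (1+|t|^alpha)^(-nu),
   written componentwise (real and imaginary part of E e^{itL}). *)
Definition is_law_L {R : realType} (alpha nu : R) (mu : probability R R) :=
  forall t : R,
    Rintegral mu setT (fun x => cos (t * x)) = (1 + `|t| `^ alpha) `^ (- nu) /\
    Rintegral mu setT (fun x => sin (t * x)) = 0.

Definition is_law_M {R : realType} (delta nu : R) (mu : probability R R) :=
  mu `[0, +oo[%classic = 1%E /\
  forall s : R, 0 <= s ->
    Rintegral mu setT (fun x => expR (- (s * x))) = (1 + s `^ delta) `^ (- nu).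

Definition cvg_dist_L {R : realType} {d : measure_display} {T : measurableType d}
  (P : probability T R) (Y : nat -> T -> R) (alpha nu : R) :=
  exists mu : probability R R, is_law_L alpha nu mu /\ cvg_dist_scaled P Y mu 1.

Definition cvg_dist_cM {R : realType} {d : measure_display} {T : measurableType d}
  (P : probability T R) (Y : nat -> T -> R) (c delta nu : R) :=
  exists mu : probability R R, is_law_M delta nu mu /\ cvg_dist_scaled P Y mu c.

(* Main.v *)
Require Import Defs.
From HB Require Import structures.
From mathcomp Require Import all_boot all_order all_algebra.
From mathcomp Require Import all_classical all_reals all_analysis.
From mathcomp Require Import measurable_realfun ring lra.
Import Order.TTheory GRing.Theory Num.Theory.
Import numFieldNormedType.Exports.
Local Open Scope classical_set_scope.
Local Open Scope ring_scope.
Set Implicit Arguments.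
Unset Strict Implicit.
Unset Printing Implicit Defensive.

(** Write [Y_n = S_{N_n} / d_n], [W_n = B_{N_n}^2 / d_n^2], and let [c_k] be the
    characteristic function of [S_k]. Conditioning on [N_n] gives
    [E exp (i t Y_n) = E c_{N_n} (t / d_n)], and the Lindeberg estimate
    [c_k (u) = exp (- u^2 B_k^2 / 2) + o(1)], uniform for [|u| B_k] bounded, shows
    [E exp (i t Y_n) - E exp (- t^2 W_n / 2) -> 0] as soon as [W_n] is tight. Tightness
    of [Y_n] and of [W_n] are equivalent. So the characteristic functions of [Y_n]
    converge to [(1 + |t|^alpha)^(- nu)] if and only if the Laplace transforms of
    [W_n / 2] converge to [(1 + s^(alpha/2))^(- nu)], with [s = t^2], and continuity
    theorems for both transforms conclude.

    For a tight sequence the continuity theorems follow from the Weierstrass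
    theorem: on a large compact set a bounded continuous function of [y] is
    uniformly close to a polynomial in [(1 + sin (a y)) / 2] (resp. in [exp (- y)]),
    whose expectation converges by hypothesis. The limit functional is tight, so
    its distribution function defines a law that represents it. *)

(** * Elementary bounds for cosine, sine and exponential *)

Section trigonometric_bounds.
Context {R : realType}.
Implicit Types x : R.

(** Both sides of the equivalence quantify the limit law existentially, so no law with the required
    transform is available beforehand: it has to be built as the limit itself, which is why
    convergence of transforms is turned into a functional and then into a measure. The variable
    [W_n] is only tight and may have no mean, hence [Y_n] no variance. Second moments of [Y_n] are
    therefore replaced by [1 - cos], and the Gaussian approximation is used only on events such as
    [W_n <= K] and [N_n > k0]. Comparing the two tightness properties requires a frequency and a
    truncation that depend on [N_n], so conditioning is stated with both as functions of [N_n].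
    Characteristic functions are handled as pairs (cosine part, sine part). Gaussian ones are real,
    so the sine part vanishes in the limit. The factor 2 on the variance side is the [1 / 2] of the
    Gaussian exponent: if [W_n] is close in law to [2 M], then [E exp (- t^2 W_n / 2)] is close to
    the Laplace transform of [M] at [t^2]. *)

Lemma ge0_derive_ge0 (f f' : R -> R) : f 0 = 0 ->
  (forall x, is_derive x 1 f (f' x)) -> (forall x, 0 <= x -> 0 <= f' x) ->
  forall x, 0 <= x -> 0 <= f x.
Proof.
move=> f0 df f'0 x x0; rewrite -f0.
have cf : {within `[0, x], continuous f}.
  apply: derivable_within_continuous => y _.
  exact: (@ex_derive _ _ _ _ _ _ _ (df y)).
have [xlt|] := ltP 0 x; last by move=> x0'; rewrite (_ : x = 0)//; apply/le_anti/andP.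
have [c cx] := MVT xlt (fun y _ => df y) cf.
move=> /eqP; rewrite subr_eq => /eqP ->.
rewrite lerDr subr0 mulr_ge0// f'0//.
by move: cx; rewrite in_itv/= => /andP[/ltW].
Qed.

(** Start of a cascade: the differences below vanish at 0 and their derivatives are nonnegative by
    earlier members, beginning with [1 - cos y >= 0]. *)
Lemma sin_le_id x : 0 <= x -> sin x <= x.
Proof.
move=> x0; rewrite -subr_ge0.
apply: (@ge0_derive_ge0 (fun y => y - sin y) (fun y => 1 - cos y)).
- by rewrite sin0 subr0.
- by move=> y _; rewrite subr_ge0 cos_le1.
- exact: x0.
Qed.

Lemma cos_ge_quadratic_pos x : 0 <= x -> 0 <= cos x - 1 + x ^+ 2 / 2.
Proof.
apply: (@ge0_derive_ge0 (fun y => cos y - 1 + y ^+ 2 / 2) (fun y => y - sin y)).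
- by rewrite cos0; lra.
- move=> y; apply: is_derive_eq.
  by rewrite /GRing.scale/=; lra.
- by move=> y y0; rewrite subr_ge0 sin_le_id.
Qed.

Lemma sin_ge_cubic_pos x : 0 <= x -> 0 <= sin x - x + x ^+ 3 / 6.
Proof.
apply: (@ge0_derive_ge0 (fun y => sin y - y + y ^+ 3 / 6)
  (fun y => cos y - 1 + y ^+ 2 / 2)).
- by rewrite sin0; lra.
- move=> y; apply: is_derive_eq.
  by rewrite /GRing.scale/=; lra.
- by move=> y y0; exact: cos_ge_quadratic_pos.
Qed.

Lemma sin_ge_quadratic_pos x : 0 <= x -> 0 <= sin x - x + x ^+ 2 / 2.
Proof.
apply: (@ge0_derive_ge0 (fun y => sin y - y + y ^+ 2 / 2)
  (fun y => cos y - 1 + y)).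
- by rewrite sin0; lra.
- move=> y; apply: is_derive_eq.
  by rewrite /GRing.scale/=; lra.
- move=> y y0; have := cos_ge_quadratic_pos y0.
  (* For [y <= 2] the quadratic bound leaves [y - y^2 / 2 >= 0]; beyond 2, [cos y >= -1]
     suffices. *)
  by have := cos_geN1 y; have [y2|y2] := leP y 2; nra.
Qed.

Lemma cos_le_cubic_pos x : 0 <= x -> 0 <= x ^+ 3 / 6 - (cos x - 1 + x ^+ 2 / 2).
Proof.
apply: (@ge0_derive_ge0 (fun y => y ^+ 3 / 6 - (cos y - 1 + y ^+ 2 / 2))
  (fun y => sin y - y + y ^+ 2 / 2)).
- by rewrite cos0; lra.
- move=> y; apply: is_derive_eq.
  by rewrite /GRing.scale/=; lra.
- by move=> y y0; exact: sin_ge_quadratic_pos.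
Qed.

(** The quadratic bound serves where [x] is large, the cubic one where it is small; Lindeberg's
    splitting needs both. *)
Lemma cos_quadratic_approx x :
  `|cos x - 1 + x ^+ 2 / 2| <= x ^+ 2 /\ `|cos x - 1 + x ^+ 2 / 2| <= `|x| ^+ 3.
Proof.
rewrite -(cos_norm x) -(real_normK (num_real x)).
have := normr_ge0 x; move: (`|x|) => y y0.
rewrite ger0_norm ?cos_ge_quadratic_pos//.
have := cos_le_cubic_pos y0; have := cos_le1 y.
have := exprn_ge0 3 y0; have := exprn_ge0 2 y0.
by move: (y ^+ 3) (y ^+ 2) (cos y) => *; split; lra.
Qed.

Lemma sin_linear_approx x :
  `|sin x - x| <= x ^+ 2 /\ `|sin x - x| <= `|x| ^+ 3.
Proof.
have H (y : R) : 0 <= y -> `|sin y - y| <= y ^+ 2 /\ `|sin y - y| <= `|y| ^+ 3.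
  move=> y0; rewrite (ger0_norm y0) ler0_norm ?subr_le0 ?sin_le_id//.
  have := sin_ge_cubic_pos y0; have := sin_ge_quadratic_pos y0.
  have := exprn_ge0 3 y0; have := exprn_ge0 2 y0.
  by move: (y ^+ 3) (y ^+ 2) (sin y) => *; split; lra.
have [/H//|/ltW x0] := leP 0 x.
have := H (- x); rewrite oppr_ge0 sinN normrN sqrrN opprK => /(_ x0).
by rewrite (_ : - sin x + x = - (sin x - x)) ?normrN//; ring.
Qed.

Lemma cos_ge_quadratic x : 1 - cos x <= x ^+ 2 / 2.
Proof.
have := @cos_ge_quadratic_pos `|x| (normr_ge0 _).
by rewrite cos_norm (real_normK (num_real x)); lra.
Qed.

(** For [|x| <= 1] the cubic remainder costs at most [x^2 / 6] out of [x^2 / 2]. *)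
Lemma cos_le_quadratic x : `|x| <= 1 -> x ^+ 2 / 4 <= 1 - cos x.
Proof.
rewrite -(cos_norm x) -(real_normK (num_real x)).
have := normr_ge0 x; move: (`|x|) => y y0 y1.
by have := cos_le_cubic_pos y0; nra.
Qed.

Lemma expRN_linear_approx x : 0 <= x -> `|expR (- x) - (1 - x)| <= x ^+ 2.
Proof.
move=> x0; have h1 := expR_ge1Dx (- x).
rewrite ger0_norm; last lra.
have h2 := expR_ge1Dx x.
rewrite lerBlDr expRN.
have p : 0 < expR x := expR_gt0 x.
(* Since [1 / (1 + x) - (1 - x) = x^2 / (1 + x)], this bound on [exp (- x)] is enough. *)
have : (expR x)^-1 <= (1 + x)^-1 by rewrite lef_pV2 ?posrE//; lra.
move=> /le_trans; apply.
rewrite -[X in _ <= X]mulr1 -ler_pdivrMl; last nra.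
by rewrite -invfM invf_le1; nra.
Qed.

End trigonometric_bounds.

(** * Expectations of integrable and of bounded measurable functions *)

Section expectation.
Context {R : realType} {d : measure_display} {T : measurableType d}.
Variable P : probability T R.
Implicit Types f g : T -> R.

Local Notation E f := (Rintegral P setT f).

Definition int_fun f : Prop := P.-integrable setT (EFin \o f).

Definition bnd_meas f : Prop :=
  measurable_fun setT f /\ exists M : R, forall x, `|f x| <= M.

Lemma bnd_meas_int f : bnd_meas f -> int_fun f.
Proof.
move=> [mf [M fM]]; apply: measurable_bounded_integrable => //.
  by rewrite (le_lt_trans (probability_le1 _ _)) ?ltry.
exists M; split; first exact: num_real.
by move=> r Mr x _ /=; rewrite (le_trans (fM x))// ltW.
Qed.

Lemma int_fun_meas f : int_fun f -> measurable_fun setT f.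
Proof. by move=> /integrableP[/measurable_EFinP]. Qed.

Lemma int_funD f g : int_fun f -> int_fun g -> int_fun (fun x => f x + g x).
Proof. exact: integrableD. Qed.

Lemma int_funB f g : int_fun f -> int_fun g -> int_fun (fun x => f x - g x).
Proof. exact: integrableB. Qed.

Lemma int_funZ a f : int_fun f -> int_fun (fun x => a * f x).
Proof. exact: integrableZl. Qed.

Lemma int_fun_cst a : int_fun (fun=> a).
Proof. by apply: bnd_meas_int; split => //; exists `|a|. Qed.

Lemma int_fun_le f g : measurable_fun setT f -> (forall x, `|f x| <= g x) ->
  int_fun g -> int_fun f.
Proof.
move=> mf fg; apply: le_integrable => //; first exact/measurable_EFinP.
by move=> x _ /=; rewrite lee_fin (le_trans (fg x)) ?ler_norm.
Qed.

Lemma int_funM f g : bnd_meas f -> int_fun g -> int_fun (fun x => f x * g x).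
Proof.
move=> [mf [M fM]] ig.
apply: (@int_fun_le _ (fun x => M * `|g x|)).
- by apply: measurable_funM => //; exact: int_fun_meas.
- by move=> x; rewrite normrM ler_wpM2r.
- exact/int_funZ/integrable_norm.
Qed.

Lemma bnd_meas_cst a : bnd_meas (fun=> a).
Proof. by split => //; exists `|a|. Qed.

Lemma bnd_measD f g : bnd_meas f -> bnd_meas g -> bnd_meas (fun x => f x + g x).
Proof.
move=> [mf [M fM]] [mg [M' gM]]; split; first exact: measurable_funD.
by exists (M + M') => x; rewrite (le_trans (ler_normD _ _))// lerD.
Qed.

Lemma bnd_measM f g : bnd_meas f -> bnd_meas g -> bnd_meas (fun x => f x * g x).
Proof.
move=> [mf [M fM]] [mg [M' gM]]; split; first exact: measurable_funM.
by exists (M * M') => x; rewrite normrM ler_pM.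
Qed.

Lemma bnd_measB f g : bnd_meas f -> bnd_meas g -> bnd_meas (fun x => f x - g x).
Proof.
move=> [mf [M fM]] [mg [M' gM]]; split; first exact: measurable_funB.
by exists (M + M') => x; rewrite (le_trans (ler_normB _ _))// lerD.
Qed.

Lemma bnd_meas_indic (A : set T) : measurable A -> bnd_meas \1_A.
Proof.
move=> mA; split; first exact: measurable_indic.
by exists 1 => x; rewrite indicE; case: (_ \in _); rewrite ?normr1 ?normr0.
Qed.

Lemma expect_cst a : E (fun=> a) = a.
Proof.
rewrite Rintegral_cst// -[RHS]mulr1; congr (_ * _).
by have : fine (P setT) = 1 by rewrite probability_setT.
Qed.

Lemma expectD f g : int_fun f -> int_fun g ->
  E (fun x => f x + g x) = E f + E g.
Proof. exact: RintegralD. Qed.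

Lemma expectB f g : int_fun f -> int_fun g ->
  E (fun x => f x - g x) = E f - E g.
Proof. exact: RintegralB. Qed.

Lemma expectZ a f : int_fun f -> E (fun x => a * f x) = a * E f.
Proof. exact: RintegralZl. Qed.

Lemma expect_indic A : measurable A -> E \1_A = fine (P A).
Proof. by move=> mA; rewrite /Rintegral integral_indic// setIT. Qed.

Lemma le_expect f g : int_fun f -> int_fun g -> (forall x, f x <= g x) ->
  E f <= E g.
Proof. by move=> *; exact: le_Rintegral. Qed.

Lemma expect_ge0 f : (forall x, 0 <= f x) -> 0 <= E f.
Proof. by move=> f0; exact: Rintegral_ge0. Qed.

Lemma norm_expect_le f g : int_fun f -> int_fun g -> (forall x, `|f x| <= g x) ->
  `|E f| <= E g.
Proof.
move=> If Ig fg; apply: (le_trans (le_normr_Rintegral _ _)) => //.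
by apply: le_Rintegral => //; exact: integrable_norm.
Qed.

Lemma expectB_norm_le f g h : int_fun f -> int_fun g -> int_fun h ->
  (forall x, `|f x - g x| <= h x) -> `|E f - E g| <= E h.
Proof.
by move=> If Ig Ih fg; rewrite -expectB//; apply: norm_expect_le => //; exact: int_funB.
Qed.

Lemma fineP_ge0 A : 0 <= fine (P A).
Proof. exact: fine_ge0. Qed.

Lemma le_fineP A B : measurable A -> measurable B -> A `<=` B ->
  fine (P A) <= fine (P B).
Proof. by move=> mA mB AB; rewrite fine_le ?fin_num_measure// le_measure ?inE. Qed.

Lemma fineP_setU_le A B : measurable A -> measurable B ->
  fine (P (A `|` B)) <= fine (P A) + fine (P B).
Proof.
move=> mA mB; rewrite -fineD ?fin_num_measure// fine_le//.
- exact/fin_num_measure/measurableU.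
- by rewrite fin_numD !fin_num_measure.
- exact: measureU2.
Qed.

(** Continuity from above at the empty set; this is how the tails of one fixed random variable are
    made small. *)
Lemma fineP_cvg0 (A : nat -> set T) : (forall n, measurable (A n)) ->
  (forall n, A n.+1 `<=` A n) -> (forall x, exists n, ~ A n x) ->
  fine (P (A n)) @[n --> \oo] --> (0 : R).
Proof.
move=> mA dA A0; apply: fine_cvg; rewrite (_ : 0%:E = P set0); last by rewrite measure0.
have <- : \bigcap_n A n = set0.
  by rewrite -subset0 => x Ax; have [n] := A0 x; apply; exact: Ax.
apply: nonincreasing_cvg_mu => //.
- by rewrite (le_lt_trans (probability_le1 _ _)) ?ltry.
- exact: bigcapT_measurable.
- by apply/nonincreasing_seqP => n; apply/subsetPset/dA.
Qed.

End expectation.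

(** * Bernstein polynomials and uniform approximation on the unit interval *)

Section bernstein.
Context {R : realType}.
Implicit Types (h : nat -> R) (x : R).

(* The expectation of [h] under the binomial law with [n] trials and success
   probability [x], by conditioning on the first trial. *)
Fixpoint bern n h x : R :=
  if n is m.+1 then x * bern m (fun k => h k.+1) x + (1 - x) * bern m h x
  else h 0%N.

Lemma bern_le n h g x : 0 <= x <= 1 -> (forall k, (k <= n)%N -> h k <= g k) ->
  bern n h x <= bern n g x.
Proof.
move=> /andP[x0 x1]; elim: n h g => [|n IH] h g hg /=; first exact: hg.
apply: lerD; apply: ler_wpM2l; rewrite ?subr_ge0//; apply: IH => k kn.
  exact: hg.
by apply: hg; rewrite (leq_trans kn).
Qed.

Lemma bernD n h g x : bern n (fun k => h k + g k) x = bern n h x + bern n g x.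
Proof. by elim: n h g => [|n IH] h g //=; rewrite !IH; ring. Qed.

Lemma bernZ n a h x : bern n (fun k => a * h k) x = a * bern n h x.
Proof. by elim: n h => [|n IH] h //=; rewrite !IH; ring. Qed.

Lemma bern_cst n a x : bern n (fun=> a) x = a.
Proof. by elim: n => [|n IH] //=; rewrite !IH; ring. Qed.

Lemma bern_id n x : bern n (fun k => k%:R) x = n%:R * x.
Proof.
elim: n => [|n IH] /=; first by rewrite mul0r.
rewrite (_ : (fun k => k.+1%:R) = (fun k => k%:R + 1 : R)); last first.
  by apply/funext => k; rewrite natr1.
by rewrite bernD bern_cst IH -natr1; ring.
Qed.

Lemma bern_sqr n x : bern n (fun k => k%:R ^+ 2) x =
  (n%:R * x) ^+ 2 + n%:R * (x * (1 - x)).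
Proof.
elim: n => [|n IH] /=; first by ring.
rewrite (_ : (fun k => k.+1%:R ^+ 2) =
    (fun k => k%:R ^+ 2 + (2 * k%:R + 1) : R)); last first.
  by apply/funext => k; rewrite -natr1; ring.
by rewrite !bernD bernZ bern_cst bern_id IH -natr1; ring.
Qed.

Lemma bern_var n x : bern n (fun k => (k%:R - n%:R * x) ^+ 2) x =
  n%:R * (x * (1 - x)).
Proof.
rewrite (_ : (fun k => (k%:R - n%:R * x) ^+ 2) =
  (fun k => k%:R ^+ 2 + ((- 2 * (n%:R * x)) * k%:R + (n%:R * x) ^+ 2))); last first.
  by apply/funext => k; ring.
by rewrite !bernD bernZ bern_cst bern_id bern_sqr; ring.
Qed.

(** Heine's theorem by a compactness covering. Only [x] is confined to the segment: [y] may lie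
    slightly outside, as it does for the Stieltjes sums. *)
Lemma continuous_unif_segment (h : R -> R) (a b e : R) : continuous h -> 0 < e ->
  exists2 dl, 0 < dl & forall x y, a <= x <= b -> `|x - y| < dl ->
    `|h x - h y| <= e.
Proof.
move=> ch e0.
have cpt : compact (`[a, b]%classic : set R) by exact: segment_compact.
have cov := (compact_near_coveringP `[a, b]%classic).1 cpt.
pose Q (dl x : R) := forall y, `|x - y| < dl -> `|h x - h y| <= e.
have /cov : forall x, `[a, b]%classic x ->
    \forall x' \near x & dl \near 0^'+, Q dl x'.
  move=> x _.
  have e2 : 0 < e / 2 by lra.
  have /cvgrPdist_lt/(_ _ e2) := ch x.
  rewrite -nbhs_ballE => -[r /= r0 xr].
  have r2 : 0 < r / 2 by rewrite divr_gt0.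
  exists (ball x (r / 2), [set dl | dl < r / 2]).
    split => /=; first exact: nbhsx_ballx.
    exact: nbhs_right_lt.
  move=> [x' dl] [/= xx' dlr] y x'y.
  have := xr x'; have := xr y; rewrite /ball/= in xx' *.
  have -> : `|x - x'| < r by lra.
  have -> : `|x - y| < r.
    have -> : x - y = (x - x') + (x' - y) by lra.
    by rewrite (le_lt_trans (ler_normD _ _))//; lra.
  move=> /(_ isT) h1 /(_ isT) h2.
  have -> : h x' - h y = (h x - h y) - (h x - h x') by lra.
  by rewrite (le_trans (ler_normB _ _))//; lra.
move=> H; have [dl [dl0 Hdl]] : exists dl, 0 < dl /\ `[a, b]%classic `<=` Q dl.
  have : \forall dl \near 0^'+, 0 < dl /\ `[a, b]%classic `<=` Q dl.
    by near=> dl; split; [near: dl; exact: nbhs_right_gt|near: dl].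
  by move=> /(@filter_ex _ _ _); exact.
exists dl => // x y xab; apply: Hdl.
by rewrite /= in_itv.
Unshelve. all: by end_near. Qed.

(** Bernstein's probabilistic proof: the frequency [k / n] concentrates around [x] by Chebyshev's
    inequality, with variance [x (1 - x) / n]. *)
Lemma bern_approx (h : R -> R) (M : R) : continuous h ->
  (forall x, 0 <= x <= 1 -> `|h x| <= M) ->
  forall e, 0 < e -> exists n, forall x, 0 <= x <= 1 ->
    `|bern n (fun k => h (k%:R / n%:R)) x - h x| <= e.
Proof.
move=> ch hM e e0.
have M0 : 0 <= M by apply: le_trans (hM 0 _) => //; rewrite lexx ler01.
have e2 : 0 < e / 2 by lra.
have [dl dl0 udl] := continuous_unif_segment 0 1 ch e2.
have [n [n0 nM]] : exists n : nat, 0 < n%:R :> R /\ 2 * M / dl ^+ 2 <= e / 2 * n%:R.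
  exists (Num.bound (2 * M / dl ^+ 2 / (e / 2))).+1; split; first by [].
  rewrite [leRHS]mulrC -ler_pdivrMr//.
  have /archi_boundP : 0 <= 2 * M / dl ^+ 2 / (e / 2).
    by rewrite !divr_ge0 ?mulr_ge0 ?exprn_ge0 ?(ltW dl0) ?(ltW e0).
  by move=> /ltW/le_trans; apply; rewrite ler_nat.
exists n => x x01.
(* Majorant of [|h (k / n) - h x|]: if [k / n] is within [dl] of [x], the first term suffices;
   otherwise [(k / n - x)^2 / dl^2 >= 1] and the second exceeds [2 M]. Its binomial mean is at most
   [e] by the choice of [n]. *)
pose g k : R := e / 2 + 2 * M / dl ^+ 2 / n%:R ^+ 2 * (k%:R - n%:R * x) ^+ 2.
have nn0 : n%:R != 0 :> R by rewrite gt_eqF.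
have gE : bern n g x <= e.
  rewrite /g bernD bern_cst bernZ bern_var.
  have -> : 2 * M / dl ^+ 2 / n%:R ^+ 2 * (n%:R * (x * (1 - x))) =
    2 * M / dl ^+ 2 / n%:R * (x * (1 - x)).
    by field; rewrite nn0 gt_eqF.
  have : 2 * M / dl ^+ 2 / n%:R <= e / 2 by rewrite ler_pdivrMr.
  have : 0 <= 2 * M / dl ^+ 2 / n%:R.
    by rewrite !divr_ge0 ?mulr_ge0 ?exprn_ge0 ?(ltW dl0) ?(ltW n0).
  move: (2 * M / dl ^+ 2 / n%:R) => q q0 qe.
  have : 0 <= x * (1 - x) <= 1 by nra.
  by move: (x * (1 - x)) => z; nra.
have hg k : (k <= n)%N -> `|h (k%:R / n%:R) - h x| <= g k.
  move=> kn.
  have k01 : 0 <= (k%:R / n%:R : R) <= 1.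
    by rewrite divr_ge0//= ler_pdivrMr// mul1r ler_nat.
  have q0 : 0 <= 2 * M / dl ^+ 2 / n%:R ^+ 2 * (k%:R - n%:R * x) ^+ 2.
    by rewrite mulr_ge0 ?sqr_ge0// !divr_ge0 ?mulr_ge0 ?exprn_ge0 ?(ltW dl0) ?(ltW n0).
  have [dlt|dge] := ltP `|k%:R / n%:R - x| dl.
    by rewrite (le_trans (udl _ _ k01 dlt))// /g lerDl.
  rewrite (@le_trans _ _ (2 * M))//.
    by rewrite (le_trans (ler_normB _ _))// mulr2n mulrDl !mul1r lerD ?hM.
  rewrite /g; apply: ler_wpDl; first exact: ltW.
  have -> : 2 * M / dl ^+ 2 / n%:R ^+ 2 * (k%:R - n%:R * x) ^+ 2 =
     2 * M * ((k%:R / n%:R - x) ^+ 2 / dl ^+ 2).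
    by field; rewrite nn0 gt_eqF.
  rewrite ler_peMr ?mulr_ge0// ler_pdivlMr ?exprn_gt0// mul1r.
  by rewrite -(real_normK (num_real (_ - x))) ler_sqr ?nnegrE ?(ltW dl0).
rewrite ler_norml; apply/andP; split.
- have := @bern_le n (fun k => h x + (- 1) * g k) (fun k => h (k%:R / n%:R)) x x01.
  rewrite bernD bern_cst bernZ => H.
  have : h x + -1 * bern n g x <= bern n (fun k => h (k%:R / n%:R)) x.
    by apply: H => k /hg; rewrite ler_norml; lra.
  by lra.
- have := @bern_le n (fun k => h (k%:R / n%:R)) (fun k => h x + g k) x x01.
  rewrite bernD bern_cst => H.
  have : bern n (fun k => h (k%:R / n%:R)) x <= h x + bern n g x.
    by apply: H => k /hg; rewrite ler_norml; lra.
  by lra.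
Qed.

End bernstein.

(** * From convergent moments to convergent expectations under tightness *)

Section convergence_of_expectations.
Context {R : realType} {d : measure_display} {T : measurableType d}.
Variable P : probability T R.

Local Notation E f := (Rintegral P setT f).

Lemma bnd_meas_comp (f : R -> R) (Y : T -> R) : continuous f ->
  (exists M : R, forall x, `|f x| <= M) -> measurable_fun setT Y ->
  bnd_meas (fun w => f (Y w)).
Proof.
move=> cf [M fM] mY; split; last by exists M.
by apply: measurableT_comp => //; exact: continuous_measurable_fun.
Qed.

Lemma bnd_measX (g : T -> R) j : bnd_meas g -> bnd_meas (fun w => g w ^+ j).
Proof.
move=> bg; elim: j => [|j IH].
  by under eq_fun do rewrite expr0; exact: bnd_meas_cst.
by under eq_fun do rewrite exprS; exact: bnd_measM.
Qed.

Lemma bnd_meas_bern (g : T -> R) m h : bnd_meas g -> bnd_meas (fun w => bern m h (g w)).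
Proof.
move=> bg; elim: m h => [|m IH] h /=; first exact: bnd_meas_cst.
apply: bnd_measD; apply: bnd_measM => //.
exact/bnd_measB/bg/bnd_meas_cst.
Qed.

Lemma cvgn_approx (u : nat -> R) :
  (forall e : R, 0 < e -> exists2 v : nat -> R, cvgn v &
    \forall n \near \oo, `|u n - v n| <= e) -> cvgn u.
Proof.
move=> H; apply: cauchy_cvg; apply: cauchy_exP => e e0.
have [|v cv uv] := H (e / 3); first by lra.
exists (limn v).
suff : \forall n \near \oo, ball (limn v) e (u n) by [].
near=> n.
rewrite /ball/= (_ : limn v - u n = (limn v - v n) - (u n - v n)); last by lra.
rewrite (le_lt_trans (ler_normB _ _))//.
have h1 : `|u n - v n| <= e / 3 by near: n.
have h2 : `|limn v - v n| < e / 3.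
  by near: n; move/cvgrPdist_lt : cv; apply; lra.
by lra.
Unshelve. all: by end_near. Qed.

(** The factor [g ^ j] makes the induction close: one step of the recursion for [bern] multiplies by
    [x] or by [1 - x], that is, raises [j] or splits into two terms. *)
Lemma cvg_expect_bern (g : nat -> T -> R) : (forall n, bnd_meas (g n)) ->
  (forall j, cvgn (fun n => E (fun w => g n w ^+ j))) ->
  forall m h j, cvgn (fun n => E (fun w => g n w ^+ j * bern m h (g n w))).
Proof.
move=> bg cg; elim => [|m IH] h j /=.
  rewrite (_ : (fun n => _) = (fun n => h 0%N * E (fun w => g n w ^+ j))).
    by apply: is_cvgMr; exact: cg.
  apply/funext => n; rewrite -expectZ; last exact/bnd_meas_int/bnd_measX.
  by congr Rintegral; apply/funext => w; rewrite mulrC.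
have bI n i k : bnd_meas (fun w => g n w ^+ i * bern m k (g n w)).
  by apply: bnd_measM; [exact: bnd_measX|exact: bnd_meas_bern].
rewrite (_ : (fun n => _) = (fun n =>
    E (fun w => g n w ^+ j.+1 * bern m (fun k => h k.+1) (g n w)) +
    (E (fun w => g n w ^+ j * bern m h (g n w)) -
     E (fun w => g n w ^+ j.+1 * bern m h (g n w))))).
  by apply: is_cvgD; [exact: IH|apply: is_cvgB; exact: IH].
apply/funext => n; rewrite -expectB; [|exact: bnd_meas_int..].
rewrite -expectD; [|exact: bnd_meas_int|apply: int_funB; exact: bnd_meas_int].
by congr Rintegral; apply/funext => w; rewrite exprS; ring.
Qed.

Definition tight_seq (Y : nat -> T -> R) : Prop := forall e : R, 0 < e ->
  exists2 K : R, 0 < K & \forall n \near \oo, fine (P [set w | K < `|Y n w|]) <= e.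

Lemma measurable_norm_gt (Y : T -> R) (K : R) : measurable_fun setT Y ->
  measurable [set w | K < `|Y w|].
Proof.
move=> mY; have := measurable_fun_ltr (@measurable_cst _ _ T _ setT K)
  (measurableT_comp (@normr_measurable R setT) mY).
move=> /(_ measurableT [set true]); rewrite setTI; apply.
by [].
Qed.

(** The map [phi] compresses the line into [[0, 1]] and [psi] undoes it on [[- K, K]], where [f] is
    thus [f \o psi] evaluated at [phi]. A Bernstein polynomial of [f \o psi] gives a combination of
    the moments of [phi], which converge by assumption. *)
Lemma cvg_expect_tight (Y : nat -> T -> R) :
  (forall n, measurable_fun setT (Y n)) -> tight_seq Y ->
  (forall K : R, 0 < K -> exists phi psi : R -> R,
    [/\ continuous phi, continuous psi, (forall n w, 0 <= phi (Y n w) <= 1),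
      (forall n w, `|Y n w| <= K -> psi (phi (Y n w)) = Y n w) &
      (forall j, cvgn (fun n => E (fun w => phi (Y n w) ^+ j)))]) ->
  forall f : R -> R, continuous f -> (exists M : R, forall x, `|f x| <= M) ->
    cvgn (fun n => E (fun w => f (Y n w))).
Proof.
move=> mY tY H f cf [M fM]; apply: cvgn_approx => e e0.
have M0 : 0 <= M by rewrite (le_trans _ (fM 0)).
(* Where [|Y n| > K] the error is at most [2 M + 1], so this tail probability makes it cost
   [e / 2]. *)
have e'0 : 0 < e / (2 * (2 * M + 1)) by rewrite divr_gt0//; lra.
have [K K0 tK] := tY _ e'0.
have [phi [psi [cphi cpsi phi01 phiK cvgphi]]] := H K K0.
have ch : continuous (f \o psi) by move=> x; apply: continuous_comp; [exact: cpsi|exact: cf].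
(* The cap at 1 keeps the polynomial within [M + 1], also outside [[- K, K]]. *)
have e4 : 0 < Num.min 1 (e / 2) by rewrite lt_min ltr01/=; lra.
have [m mP] := bern_approx ch (fun x _ => fM (psi x)) e4.
pose h := fun k => (f \o psi) (k%:R / m%:R).
have bphi n : bnd_meas (fun w => phi (Y n w)).
  split; last first.
    by exists 1 => w; have := phi01 n w; rewrite ler_norml; lra.
  by apply: measurableT_comp => //; exact: continuous_measurable_fun.
exists (fun n => E (fun w => bern m h (phi (Y n w)))).
  have := @cvg_expect_bern _ bphi cvgphi m h 0%N.
  by under eq_fun do under eq_Rintegral do rewrite expr0 mul1r.
near=> n.
have mA := measurable_norm_gt K (mY n).
set A := [set w | K < `|Y n w|] in mA.
have -> : e = E (fun=> e / 2) + (2 * M + 1) * (e / (2 * (2 * M + 1))).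
  by rewrite expect_cst; field; lra.
apply: (@le_trans _ _ (E (fun w => e / 2 + (2 * M + 1) * \1_A w))).
  apply: expectB_norm_le.
  - by apply/bnd_meas_int/bnd_meas_comp => //; exists M.
  - exact/bnd_meas_int/bnd_meas_bern.
  - apply: int_funD; first exact: int_fun_cst.
    exact/int_funZ/bnd_meas_int/bnd_meas_indic.
  move=> w; have := mP _ (phi01 n w); rewrite -/h /=.
  set b := bern _ _ _ => bP.
  have [YK|YK] := leP `|Y n w| K.
    rewrite distrC; move: bP; rewrite phiK// => /le_trans; apply.
    rewrite (@le_trans _ _ (e / 2)) ?ge_min ?lexx ?orbT//.
    by rewrite lerDl mulr_ge0//; lra.
  rewrite indicE mem_set// mulr1.
  have := fM (Y n w); have := fM (psi (phi (Y n w))).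
  have : `|b - f (psi (phi (Y n w)))| <= 1 by rewrite (le_trans bP)// ge_min lexx.
  by rewrite !ler_norml; lra.
rewrite expectD; [|exact: int_fun_cst|exact/int_funZ/bnd_meas_int/bnd_meas_indic].
rewrite (expectZ (2 * M + 1) (bnd_meas_int P (bnd_meas_indic mA))).
rewrite lerD2l expect_indic// ler_pM2l; last by lra.
by rewrite /A; near: n.
Unshelve. all: by end_near. Qed.

End convergence_of_expectations.

(** * A probability measure with a given distribution function *)

Section law_of_cdf.
Context {R : realType}.

Lemma probability_of_cdf (F : R -> R) : nondecreasing F -> right_continuous F ->
  F @ -oo --> (0 : R) -> F @ +oo --> (1 : R) ->
  exists mu : probability R R, forall r, mu `]-oo, r]%classic = (F r)%:E.
Proof.
move=> ndF rcF F0 F1.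
pose m1 := isCumulative.Build R _ R F ndF rcF.
pose m2 := isCumulativeBounded.Build R 0 1 F F0 F1.
pose G : cumulativeBounded (0 : R) (1 : R) := HB.pack F m1 m2.
eexists (distribution (lebesgue_stieltjes_measure G : probability (measurableTypeR R) R) _) => r.
exact: (cdf_lebesgue_stieltjes_id G).
Qed.

End law_of_cdf.

(** * Representation of tight positive functionals by laws *)

Section tight_functionals.
Context {R : realType}.
Implicit Types (f g : R -> R) (L : (R -> R) -> R).

Definition Cb f : Prop := continuous f /\ exists M : R, forall x, `|f x| <= M.

(** What a limit of expectations along a tight sequence retains. Tightness is phrased with test
    functions vanishing on [[- K, K]], because [L] is only meaningful on continuous functions and
    cannot be applied to indicators. *)
Record tight_functional L : Prop := TightFunctional {
  tfD : forall f g, Cb f -> Cb g -> L (fun x => f x + g x) = L f + L g ;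
  tfZ : forall a f, Cb f -> L (fun x => a * f x) = a * L f ;
  tf_le : forall f g, Cb f -> Cb g -> (forall x, f x <= g x) -> L f <= L g ;
  tf1 : L (fun=> 1) = 1 ;
  tf_tight : forall e : R, 0 < e -> exists2 K : R, 0 < K & forall f, Cb f ->
    (forall x, 0 <= f x <= 1) -> (forall x, `|x| <= K -> f x = 0) -> L f <= e }.

Lemma Cb_cst (a : R) : Cb (fun=> a).
Proof. by split; [move=> x; exact: cvg_cst|exists `|a|]. Qed.

Lemma CbD f g : Cb f -> Cb g -> Cb (fun x => f x + g x).
Proof.
move=> [cf [M fM]] [cg [M' gM]]; split.
  by move=> x; apply: cvgD; [exact: cf|exact: cg].
by exists (M + M') => x; rewrite (le_trans (ler_normD _ _))// lerD.
Qed.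

Lemma CbZ (a : R) f : Cb f -> Cb (fun x => a * f x).
Proof.
move=> [cf [M fM]]; split; first by move=> x; apply: cvgMr; exact: cf.
by exists (`|a| * M) => x; rewrite normrM ler_wpM2l.
Qed.

Lemma CbB f g : Cb f -> Cb g -> Cb (fun x => f x - g x).
Proof.
move=> Cf Cg; have := CbD Cf (CbZ (-1) Cg).
by under eq_fun do rewrite mulN1r.
Qed.

Lemma Cb_sum m (a : nat -> R) (r : nat -> R -> R) : (forall j, Cb (r j)) ->
  Cb (fun y => \sum_(j < m) a j * r j y).
Proof.
move=> Cr; elim: m => [|m IH].
  by under eq_fun do rewrite big_ord0; exact: Cb_cst.
under eq_fun do rewrite big_ord_recr/=; apply: CbD => //; exact: CbZ.
Qed.

(** Continuous majorant of the indicator of []-oo, x]]: it is 1 up to [x], falls with slope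
    [- (k + 1)], and is 0 from [x + 1 / (k + 1)] on. It decreases to that indicator as [k] grows. *)
Definition ramp (x : R) (k : nat) (y : R) : R :=
  Num.max 0 (Num.min 1 (1 - k.+1%:R * (y - x))).

Lemma ramp01 x k y : 0 <= ramp x k y <= 1.
Proof. by rewrite /ramp le_max lexx/= ge_max ler01 ge_min lexx. Qed.

Lemma Cb_ramp x k : Cb (ramp x k).
Proof.
split; last first.
  by exists 1 => y; have := ramp01 x k y; rewrite ler_norml; lra.
move=> y; pose u (z : R) : R := 1 - k.+1%:R * (z - x).
have cu : {for y, continuous u}.
  apply: cvgB; first exact: cvg_cst.
  by apply: cvgMr; apply: cvgB; [exact: cvg_id|exact: cvg_cst].
have c1 : {for y, continuous (fun z => Num.min 1 (u z))}.
  by apply: (@continuous_min _ _ (cst 1)) => //; exact: cvg_cst.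
by apply: (@continuous_max _ _ (cst 0) (fun z => Num.min 1 (u z))) => //; exact: cvg_cst.
Qed.

Lemma ramp_eq1 x k y : y <= x -> ramp x k y = 1.
Proof.
move=> yx; rewrite /ramp min_l ?max_r//.
by rewrite -[leLHS]subr0 lerD2l lerN2 mulr_ge0_le0// subr_le0.
Qed.

Lemma ramp_eq0 x k y : x + k.+1%:R^-1 <= y -> ramp x k y = 0.
Proof.
move=> yx; rewrite /ramp max_l// ge_min; apply/orP; right.
have k0 : 0 < k.+1%:R :> R by [].
have : k.+1%:R^-1 * k.+1%:R <= (y - x) * k.+1%:R :> R.
  by rewrite ler_pM2r// lerBrDl.
by rewrite mulVf ?gt_eqF// mulrC subr_le0.
Qed.

Lemma ramp_shift x x' k y : x <= x' ->
  ramp x k y <= ramp x' k y <= ramp x k y + k.+1%:R * (x' - x).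
Proof.
move=> xx'; rewrite /ramp.
have k0 : 0 < k.+1%:R :> R by [].
have p : 0 <= k.+1%:R * (x' - x) by rewrite mulr_ge0 ?subr_ge0// ltW.
have -> : 1 - k.+1%:R * (y - x') = 1 - k.+1%:R * (y - x) + k.+1%:R * (x' - x) by ring.
move: (1 - _) (k.+1%:R * _) p => u v v0.
by rewrite !maxEle !minEle; repeat case: ifP => //; lra.
Qed.

Lemma ramp_decr x k k' y : (k <= k')%N -> ramp x k' y <= ramp x k y.
Proof.
move=> kk'; have [yx|xy] := leP y x; first by rewrite !ramp_eq1.
have : k.+1%:R * (y - x) <= k'.+1%:R * (y - x).
  by rewrite ler_pM2r ?subr_gt0// ler_nat.
rewrite /ramp; move: (k.+1%:R * _) (k'.+1%:R * _) => u v uv.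
by rewrite !maxEle !minEle; repeat case: ifP => //; lra.
Qed.

(** * The distribution function of a tight functional *)

Section one_functional.
Variable L : (R -> R) -> R.
Hypothesis tL : tight_functional L.

Lemma tf_cst a : L (fun=> a) = a.
Proof.
by have := tfZ tL a (Cb_cst 1); rewrite (tf1 tL) !mulr1.
Qed.

Lemma tfB f g : Cb f -> Cb g -> L (fun x => f x - g x) = L f - L g.
Proof.
move=> Cf Cg; have := tfD tL Cf (CbZ (-1) Cg); rewrite (tfZ tL)// mulN1r.
by under eq_fun do rewrite mulN1r.
Qed.

Lemma tf_sum m (a : nat -> R) (r : nat -> R -> R) : (forall j, Cb (r j)) ->
  L (fun y => \sum_(j < m) a j * r j y) = \sum_(j < m) a j * L (r j).
Proof.
move=> Cr; elim: m => [|m IH].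
  by under eq_fun do rewrite big_ord0; rewrite big_ord0 tf_cst.
under eq_fun do rewrite big_ord_recr/=.
rewrite (tfD tL) ?IH ?(tfZ tL) ?big_ord_recr//; first exact: Cb_sum.
exact: CbZ.
Qed.

Lemma tf_norm_le f g : Cb f -> Cb g -> (forall x, `|f x| <= g x) -> `|L f| <= L g.
Proof.
move=> Cf Cg fg; rewrite ler_norml; apply/andP; split.
  have := tf_le tL (CbZ (-1) Cg) Cf; rewrite (tfZ tL)// mulN1r; apply => x.
  by have := fg x; rewrite ler_norml; lra.
by apply: tf_le => // x; have := fg x; rewrite ler_norml; lra.
Qed.

Lemma tf_ramp01 x k : 0 <= L (ramp x k) <= 1.
Proof.
rewrite -{1}(tf_cst 0) -(tf1 tL).
by apply/andP; split; apply: tf_le => //; try exact: Cb_cst; try exact: Cb_ramp;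
  move=> y; have /andP[] := ramp01 x k y.
Qed.

(** Candidate for the mass of []-oo, x]]. Approaching the half-line from above is what makes it
    right continuous. *)
Definition tf_cdf x := inf (range (fun k => L (ramp x k))).

Lemma has_inf_tf_ramp x : has_inf (range (fun k => L (ramp x k))).
Proof.
split; first by exists (L (ramp x 0)), 0%N.
by exists 0 => _ [k _ <-]; have /andP[] := tf_ramp01 x k.
Qed.

Lemma tf_cdf_le x k : tf_cdf x <= L (ramp x k).
Proof. by apply: ge_inf; [exact: (has_inf_tf_ramp x).2|exists k]. Qed.

Lemma le_tf_cdf x b : (forall k, b <= L (ramp x k)) -> b <= tf_cdf x.
Proof.
move=> H; apply: lb_le_inf; first exact: (has_inf_tf_ramp x).1.
by move=> _ [k _ <-].
Qed.

Lemma tf_cdf_near x e : 0 < e -> exists k, L (ramp x k) < tf_cdf x + e.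
Proof.
move=> e0; have [_ [k _ <-] H] := inf_adherent e0 (has_inf_tf_ramp x).
by exists k.
Qed.

Lemma tf_cdf_cvg x : L (ramp x k) @[k --> \oo] --> tf_cdf x.
Proof.
apply/cvgrPdist_le => e e0; have [k0 hk0] := tf_cdf_near x e0.
near=> k.
have h1 := tf_cdf_le x k.
have h2 : L (ramp x k) <= L (ramp x k0).
  apply: tf_le => //; try exact: Cb_ramp.
  by move=> y; apply: ramp_decr; near: k; exact: nbhs_infty_ge.
by rewrite ler_norml; lra.
Unshelve. all: by end_near. Qed.

Lemma tf_cdf_nondecreasing : nondecreasing tf_cdf.
Proof.
move=> x y xy; apply: le_tf_cdf => k; apply: (le_trans (tf_cdf_le x k)).
apply: tf_le => //; try exact: Cb_ramp.
by move=> z; have /andP[] := ramp_shift k z xy.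
Qed.

(** An infimum is nearly attained at one [k], and moving [a] to [x] raises that single ramp by at
    most [(k + 1) (x - a)]. *)
Lemma tf_cdf_right_continuous : right_continuous tf_cdf.
Proof.
move=> a; apply/cvgrPdist_le => e e0.
have e2 : 0 < e / 2 by lra.
have [k hk] := tf_cdf_near a e2.
have k0 : 0 < k.+1%:R :> R by [].
near=> x.
have ax : a <= x by apply: ltW; near: x; exact: nbhs_right_gt.
have xa : k.+1%:R * (x - a) <= e / 2.
  rewrite mulrC -ler_pdivlMr// lerBlDl; apply: ltW.
  by near: x; apply: nbhs_right_lt; rewrite ltrDl divr_gt0.
have h1 := tf_cdf_nondecreasing ax.
have h2 := tf_cdf_le x k.
have h3 : L (ramp x k) <= L (ramp a k) + k.+1%:R * (x - a).
  rewrite -[X in _ + X]tf_cst -(tfD tL); [|exact: Cb_ramp|exact: Cb_cst].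
  apply: tf_le => //; first exact: Cb_ramp.
    by apply: CbD; [exact: Cb_ramp|exact: Cb_cst].
  by move=> y; have /andP[] := ramp_shift k y ax.
by rewrite ler_norml; lra.
Unshelve. all: by end_near. Qed.

Lemma tf_cdf_Ny : tf_cdf @ -oo --> (0 : R).
Proof.
apply/cvgrPdist_le => e e0; have [K K0 HK] := tf_tight tL e0.
near=> x.
(* The ramp of index 0 vanishes only from [x + 1] on, whence the [- 1]. *)
have xK : x <= - K - 1 by near: x; apply: nbhs_ninfty_le; exact: num_real.
have h1 := tf_cdf_le x 0.
have h2 : L (ramp x 0) <= e.
  apply: HK; [exact: Cb_ramp|exact: ramp01|move=> y].
  by rewrite ler_norml => yK; apply: ramp_eq0; rewrite invr1; lra.
have h3 : 0 <= tf_cdf x by apply: le_tf_cdf => k; have /andP[] := tf_ramp01 x k.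
by rewrite ler_norml; lra.
Unshelve. all: by end_near. Qed.

Lemma tf_cdf_y : tf_cdf @ +oo --> (1 : R).
Proof.
apply/cvgrPdist_le => e e0; have [K K0 HK] := tf_tight tL e0.
near=> x.
have xK : K <= x by near: x; apply: nbhs_pinfty_ge; exact: num_real.
have h1 := tf_cdf_le x 0.
have /andP[_ h2] := tf_ramp01 x 0.
have h3 : 1 - e <= tf_cdf x.
  apply: le_tf_cdf => k.
  suff : L (fun y => 1 - ramp x k y) <= e.
    by rewrite tfB; [rewrite tf_cst; lra|exact: Cb_cst|exact: Cb_ramp].
  apply: HK; first by apply: CbB; [exact: Cb_cst|exact: Cb_ramp].
    by move=> y; have := ramp01 x k y; lra.
  by move=> y; rewrite ler_norml => yK; rewrite ramp_eq1 ?subrr//; lra.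
by rewrite ler_norml; lra.
Unshelve. all: by end_near. Qed.

End one_functional.

(* Stieltjes sums of [f] along the grid [x0 + j h] approximate [L f], and in the
   limit of steep ramps they only involve the distribution function [F]. *)
Lemma tf_stieltjes L (F : R -> R) f (M e h x0 : R) m : tight_functional L ->
  (forall x, L (ramp x k) @[k --> \oo] --> F x) -> 0 < h -> Cb f -> 0 <= M ->
  (forall x, `|f x| <= M) ->
  (forall j y, (j <= m)%N -> `|x0 + j%:R * h - y| <= h ->
     `|f (x0 + j%:R * h) - f y| <= e) -> 0 <= e ->
  (forall k, L (fun y => 1 - ramp (x0 + m%:R * h) k y + ramp x0 k y) <= e) ->
  `|L f - \sum_(j < m) f (x0 + j.+1%:R * h) *
     (F (x0 + j.+1%:R * h) - F (x0 + j%:R * h))| <= e + M * e.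
Proof.
move=> tL LF h0 Cf M0 fM fe e0 Le.
pose r k j := ramp (x0 + j%:R * h) k.
pose a (j : nat) := f (x0 + j.+1%:R * h).
have xS j : x0 + j%:R * h <= x0 + j.+1%:R * h by rewrite lerD2l ler_pM2r// ler_nat.
have Cd k j : Cb (fun y => r k j.+1 y - r k j y) by apply: CbB; exact: Cb_ramp.
have cv : (fun k => `|L f - \sum_(j < m) a j * (L (r k j.+1) - L (r k j))|) @ \oo -->
    `|L f - \sum_(j < m) f (x0 + j.+1%:R * h) *
     (F (x0 + j.+1%:R * h) - F (x0 + j%:R * h))|.
  apply: cvg_norm; apply: cvgB; first exact: cvg_cst.
  elim: (m) => [|m' IH].
    by rewrite big_ord0; under eq_fun do rewrite big_ord0; exact: cvg_cst.
  rewrite big_ord_recr/=; under eq_fun do rewrite big_ord_recr/=.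
  apply: cvgD => //; apply: cvgMr.
  by apply: cvgB; exact: LF.
apply: (cvgr_to_le cv).
near=> k.
(* Ramps narrower than the mesh: the difference of two neighbouring ones then lives within [h] of
   the right grid point, where [f] is sampled. *)
have kh : k.+1%:R^-1 <= h.
  by apply: ltW; near: k; exact: near_infty_natSinv_lt (PosNum h0).
have -> : \sum_(j < m) a j * (L (r k j.+1) - L (r k j)) =
    L (fun y => \sum_(j < m) a j * (r k j.+1 y - r k j y)).
  rewrite (@tf_sum L tL m a (fun j y => r k j.+1 y - r k j y))//.
  by apply: eq_bigr => j _; rewrite (tfB tL)//; exact: Cb_ramp.
have CS : Cb (fun y => \sum_(j < m) a j * (r k j.+1 y - r k j y)).
  exact: (@Cb_sum m a (fun j y => r k j.+1 y - r k j y)).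
rewrite -(tfB tL)//.
(* The part of the constant 1 that the telescoping ramp differences leave uncovered; it is
   concentrated away from the grid. *)
pose g y := 1 - r k m y + r k 0%N y.
have Cg : Cb g by apply: CbD; [apply: CbB; [exact: Cb_cst|exact: Cb_ramp]|exact: Cb_ramp].
apply: (@le_trans _ _ (L (fun y => e + M * g y))); last first.
  rewrite (tfD tL) ?(tf_cst tL) ?(tfZ tL)//; [|exact: Cb_cst|exact: CbZ].
  rewrite lerD2l ler_wpM2l// /g /r mul0r addr0; exact: Le.
apply: tf_norm_le => //.
- exact: CbB.
- by apply: CbD; [exact: Cb_cst|exact: CbZ].
move=> y.
have tel : \sum_(j < m) (r k j.+1 y - r k j y) = r k m y - r k 0%N y.
  by rewrite -(big_mkord xpredT (fun j => r k j.+1 y - r k j y)) telescope_sumr.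
have rS j : 0 <= r k j.+1 y - r k j y.
  by rewrite subr_ge0; have /andP[] := ramp_shift k y (xS j).
have -> : f y - \sum_(j < m) a j * (r k j.+1 y - r k j y) =
    \sum_(j < m) (f y - a j) * (r k j.+1 y - r k j y) + f y * g y.
  under [in RHS]eq_bigr do rewrite mulrBl.
  by rewrite sumrB -mulr_sumr tel /g; ring.
have g0 : 0 <= g y by have := ramp01 (x0 + m%:R * h) k y; have := ramp01 (x0 + 0%:R * h) k y; rewrite /g /r; lra.
rewrite (le_trans (ler_normD _ _))// lerD//; last first.
  by rewrite normrM (ger0_norm g0) ler_wpM2r.
rewrite (le_trans (ler_norm_sum _ _ _))//.
apply: (@le_trans _ _ (\sum_(j < m) e * (r k j.+1 y - r k j y))); last first.
  rewrite -mulr_sumr tel ler_piMr//.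
  by have := ramp01 (x0 + m%:R * h) k y; have := ramp01 (x0 + 0%:R * h) k y; rewrite /r; lra.
apply: ler_sum => j _; rewrite normrM (ger0_norm (rS j)).
have [yj|yj] := leP y (x0 + j%:R * h).
  by rewrite /r !ramp_eq1 ?subrr ?mulr0//; exact: le_trans (xS j).
have [jy|jy] := leP (x0 + j.+1%:R * h + h) y.
  have zy z : z <= x0 + j.+1%:R * h -> z + k.+1%:R^-1 <= y.
    by move=> zj; rewrite (le_trans _ jy)// lerD.
  by rewrite /r !ramp_eq0 ?subrr ?mulr0// zy.
apply: ler_wpM2r => //; rewrite distrC; apply: fe => //.
rewrite ler_norml; move: yj jy; rewrite -natr1 mulrDl mul1r.
by move: (j%:R * h) => z; lra.
Unshelve. all: by end_near. Qed.

(** Both values are within [e + M * e] of one and the same Stieltjes sum, which depends on [F] and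
    [f] only. *)
Lemma tf_unique L L' (F : R -> R) : tight_functional L -> tight_functional L' ->
  (forall x, L (ramp x k) @[k --> \oo] --> F x) ->
  (forall x, L' (ramp x k) @[k --> \oo] --> F x) ->
  forall f, Cb f -> L f = L' f.
Proof.
move=> tL tL' LF LF' f Cf; have [cf [M fM]] := Cf.
have M0 : 0 <= M by rewrite (le_trans _ (fM 0)).
apply/eqP; rewrite -subr_eq0 -normr_le0; apply/ler_addgt0Pr => e' e'0; rewrite add0r.
pose e := e' / (2 * (1 + M)).
have e0 : 0 < e by rewrite divr_gt0//; lra.
have [K K0 HK] := tf_tight tL e0.
have [K' K'0 HK'] := tf_tight tL' e0.
(* One unit of room on the left: for every [k], the ramp starting at [x0] has reached 0 at
   [- (K + K')], so the uncovered part vanishes on [[- (K + K'), K + K']]. *)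
pose x0 := - (K + K') - 1.
have [dl dl0 Hdl] := continuous_unif_segment x0 (K + K') cf e0.
pose W := 2 * (K + K') + 1.
have W0 : 0 < W by rewrite /W; lra.
pose m := (Num.bound (W / dl)).+1.
have m0 : 0 < m%:R :> R by [].
pose h := W / m%:R.
have h0 : 0 < h by rewrite divr_gt0.
have hdl : h < dl.
  rewrite /h ltr_pdivrMr// mulrC -ltr_pdivrMr//.
  rewrite (lt_le_trans (archi_boundP _)) ?ler_nat//.
  by rewrite divr_ge0 ?ltW.
have xm : x0 + m%:R * h = K + K'.
  by rewrite /h mulrCA divff ?gt_eqF// mulr1 /x0 /W; ring.
have fe j y : (j <= m)%N -> `|x0 + j%:R * h - y| <= h ->
     `|f (x0 + j%:R * h) - f y| <= e.
  move=> jm jy; apply: Hdl; last exact: le_lt_trans hdl.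
  rewrite lerDl mulr_ge0 ?(ltW h0)//= -xm lerD2l ler_pM2r// ler_nat//.
pose g k y := 1 - ramp (x0 + m%:R * h) k y + ramp x0 k y.
have Cg k : Cb (g k).
  by apply: CbD; [apply: CbB; [exact: Cb_cst|exact: Cb_ramp]|exact: Cb_ramp].
have g01 k y : 0 <= g k y <= 1.
  have : ramp x0 k y <= ramp (x0 + m%:R * h) k y.
    have : x0 <= x0 + m%:R * h by rewrite lerDl mulr_ge0// ltW.
    by move=> /(ramp_shift k y) /andP[].
  by have := ramp01 (x0 + m%:R * h) k y; have := ramp01 x0 k y; rewrite /g; lra.
have gK k y : `|y| <= K + K' -> g k y = 0.
  rewrite ler_norml /g xm => yK; rewrite ramp_eq1; last by lra.
  rewrite subrr add0r ramp_eq0//.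
  have : k.+1%:R^-1 <= 1 :> R by rewrite invf_le1// ler1n.
  by rewrite /x0; move: (k.+1%:R^-1) => z; lra.
have A := @tf_stieltjes L F f M e h x0 m tL LF h0 Cf M0 fM fe (ltW e0).
have A' := @tf_stieltjes L' F f M e h x0 m tL' LF' h0 Cf M0 fM fe (ltW e0).
have LK k : L (g k) <= e.
  by apply: HK => // y yK; apply: gK; rewrite (le_trans yK)// lerDl ltW.
have LK' k : L' (g k) <= e.
  by apply: HK' => // y yK; apply: gK; rewrite (le_trans yK)// lerDr ltW.
move: (A LK) (A' LK'); set S := \sum_(_ < _) _ => h1 h2.
have -> : L f - L' f = (L f - S) - (L' f - S) by lra.
rewrite (le_trans (ler_normB _ _))//.
have -> : e' = e + M * e + (e + M * e) by rewrite /e; field; lra.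
exact: lerD.
Qed.

(** Puts integration against a law on the same footing as [L], so that the uniqueness statement can
    compare the two. *)
Lemma tf_expect (mu : probability R R) :
  tight_functional (fun f => Rintegral mu setT f).
Proof.
have ICb f : Cb f -> int_fun mu f.
  by move=> [cf [M fM]]; apply: bnd_meas_int; split;
    [exact: continuous_measurable_fun|exists M].
split.
- by move=> f g Cf Cg; rewrite expectD//; exact: ICb.
- by move=> a f Cf; rewrite expectZ//; exact: ICb.
- by move=> f g Cf Cg; apply: le_expect; exact: ICb.
- exact: expect_cst.
- move=> e e0.
  pose A n := [set x : R | n.+1%:R < `|x|].
  have mA n : measurable (A n) by exact: (measurable_norm_gt _ (@measurable_id _ _ setT)).
  have : fine (mu (A n)) @[n --> \oo] --> (0 : R).
    apply: fineP_cvg0 => //.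
    - by move=> n x; rewrite /A/=; apply: le_lt_trans; rewrite ler_nat.
    - move=> x; exists (Num.bound `|x|); rewrite /A/= => /lt_trans.
      move=> /(_ _ (archi_boundP (normr_ge0 x))).
      by rewrite ltr_nat ltnNge leqnSn.
  move=> /cvgrPdist_le/(_ _ e0)[n _ /(_ n (leqnn n))].
  rewrite sub0r normrN ger0_norm ?fineP_ge0// => An.
  exists n.+1%:R => // f Cf f01 f0.
  rewrite (le_trans _ An)// -expect_indic//.
  apply: le_expect; [exact: ICb|exact/bnd_meas_int/bnd_meas_indic|move=> x].
  have [xn|xn] := leP `|x| n.+1%:R; first by rewrite f0.
  by rewrite indicE mem_set//; have /andP[] := f01 x.
Qed.

(** The measure with distribution function [tf_cdf L] integrates [ramp x k] to a value between
    [tf_cdf L x] and [tf_cdf L (x + 1 / (k + 1))]. Right continuity gives it the same ramp limits as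
    [L], and uniqueness applies. *)
Lemma tf_law L : tight_functional L ->
  exists mu : probability R R, forall f, Cb f -> L f = Rintegral mu setT f.
Proof.
move=> tL.
have [mu muF] := probability_of_cdf (tf_cdf_nondecreasing tL)
  (tf_cdf_right_continuous tL) (tf_cdf_Ny tL) (tf_cdf_y tL).
exists mu => f Cf.
have tmu := tf_expect mu.
apply: (tf_unique tL tmu (tf_cdf_cvg tL)) => // x.
apply/cvgrPdist_le => e e0.
have muE y : fine (mu `]-oo, y]%classic) = tf_cdf L y by rewrite muF.
have ICb g : Cb g -> int_fun mu g.
  by move=> [cg [M gM]]; apply: bnd_meas_int; split;
    [exact: continuous_measurable_fun|exists M].
have ind y : int_fun mu \1_(`]-oo, y]%classic).
  by apply: bnd_meas_int; apply: bnd_meas_indic.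
have : \forall y \near x^'+, `|tf_cdf L x - tf_cdf L y| <= e.
  by have /cvgrPdist_le := @tf_cdf_right_continuous L tL x; apply.
rewrite near_withinE -nbhs_ballE => -[dl /= dl0 Hdl].
near=> k.
have kdl : k.+1%:R^-1 < dl.
  by near: k; exact: near_infty_natSinv_lt (PosNum dl0).
have h1 : tf_cdf L x <= Rintegral mu setT (ramp x k).
  rewrite -muE -expect_indic//; apply: le_expect; [exact: ind|exact/ICb/Cb_ramp|].
  move=> y; rewrite indicE; have [yx|yx] := leP y x.
    by rewrite ramp_eq1// ; case: (_ \in _).
  rewrite memNset /=; first by have /andP[] := ramp01 x k y.
  by rewrite in_itv/= leNgt yx.
have h2 : Rintegral mu setT (ramp x k) <= tf_cdf L (x + k.+1%:R^-1).
  rewrite -muE -expect_indic//; apply: le_expect; [exact/ICb/Cb_ramp|exact: ind|].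
  move=> y; rewrite indicE; have [yx|yx] := leP (x + k.+1%:R^-1) y.
    by rewrite ramp_eq0.
  rewrite mem_set /=; first by have /andP[] := ramp01 x k y.
  by rewrite in_itv/= ltW.
have k0 : 0 < k.+1%:R^-1 :> R by rewrite invr_gt0.
have := Hdl (x + k.+1%:R^-1).
rewrite /ball/= opprD addrA subrr sub0r normrN gtr0_norm// => /(_ kdl).
rewrite ltrDl k0 => /(_ isT).
by rewrite !ler_norml; lra.
Unshelve. all: by end_near. Qed.

End tight_functionals.

(** * Uniform approximation of bounded measurable functions by staircases *)

Section uniform_approximation.
Context {R : realType}.

(** The sum counts the integers of [[1, n]] not exceeding [y]: it is the integer part of [y], capped
    at [n]. *)
Lemma sum_floor (y : R) n : 0 <= y ->
  [/\ \sum_(i < n) (i.+1%:R <= y)%R%:R <= y,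
      y <= n%:R -> y <= \sum_(i < n) (i.+1%:R <= y)%R%:R + 1 &
      n%:R <= y -> \sum_(i < n) (i.+1%:R <= y)%R%:R = n%:R :> R].
Proof.
move=> y0; elim: n => [|n [IH1 IH2 IH3]].
  by rewrite big_ord0; split => //; lra.
rewrite big_ord_recr/=; move: IH1 IH2 IH3; set S := \sum_(_ < _) _ => IH1 IH2 IH3.
have [ny|ny] := leP n.+1%:R y.
  have Sn : S = n%:R by apply: IH3; rewrite (le_trans _ ny)// ler_nat.
  by rewrite Sn natr1; split => //; lra.
split => //=; rewrite ?addr0// => yn.
have [/IH2//|/ltW/IH3 ->] := leP y n%:R; first by rewrite natr1.
Qed.

(** Rounding [f + M] down to a multiple of [e] writes it as a sum of indicators of superlevel sets,
    all with the same weight [e]. *)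
Lemma bounded_simple_approx (f : R -> R) (M e : R) : measurable_fun setT f ->
  (forall x, `|f x| <= M) -> 0 < e ->
  exists n (A : nat -> set R), (forall i, measurable (A i)) /\
    forall x, `|f x - (- M + e * \sum_(i < n) \1_(A i) x)| <= e.
Proof.
move=> mf fM e0.
pose A (i : nat) := [set x | i.+1%:R * e - M <= f x].
have M0 : 0 <= M by rewrite (le_trans _ (fM 0)).
pose n := Num.bound (2 * M / e).
exists n, A; split.
  move=> i; rewrite -[A i]setTI.
  have -> : A i = f @^-1` `[i.+1%:R * e - M, +oo[%classic.
    by apply/seteqP; split => x /=; rewrite in_itv/= andbT.
  exact: mf.
move=> x; have := fM x; rewrite ler_norml => /andP[fM1 fM2].
have y0 : 0 <= (f x + M) / e by rewrite divr_ge0 ?(ltW e0)//; lra.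
have [S1 S2 _] := sum_floor n y0.
have yn : (f x + M) / e <= n%:R.
  apply: (@le_trans _ _ (2 * M / e)); first by rewrite ler_pM2r ?invr_gt0//; lra.
  by rewrite /n ltW// archi_boundP// divr_ge0 ?mulr_ge0 ?(ltW e0).
move: S1 (S2 yn).
have -> : \sum_(i < n) (i.+1%:R <= (f x + M) / e)%R%:R = \sum_(i < n) \1_(A i) x :> R.
  apply: eq_bigr => i _; rewrite indicE; congr (nat_of_bool _)%:R.
  rewrite ler_pdivlMr//; apply/idP/idP => h.
    by apply/mem_set; rewrite /A/=; lra.
  by move: h => /set_mem; rewrite /A/=; lra.
set S := \sum_(_ < _) _; rewrite ler_pdivlMr// ler_pdivrMr// => h1 h2.
by rewrite ler_norml; nra.
Qed.

End uniform_approximation.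

(** * Independence tested on bounded functions *)

Section independence.
Context {R : realType} {d : measure_display} {T : measurableType d}.
Variable P : probability T R.

Local Notation E f := (Rintegral P setT f).

Lemma bnd_meas_mcomp (f : R -> R) (Z : T -> R) : measurable_fun setT f ->
  (exists M : R, forall x, `|f x| <= M) -> measurable_fun setT Z ->
  bnd_meas (fun w => f (Z w)).
Proof.
by move=> mf [M fM] mZ; split; [exact: measurableT_comp|exists M].
Qed.

Lemma bnd_meas_indic_comp (A : set R) (Z : T -> R) : measurable A ->
  measurable_fun setT Z -> bnd_meas (fun w => \1_A (Z w) : R).
Proof.
by move=> mA; apply: bnd_meas_mcomp; [exact: measurable_indic|];
  exists 1 => x; rewrite indicE; case: (_ \in _); rewrite ?normr1 ?normr0.
Qed.

Lemma bnd_meas_prod n (h : nat -> T -> R) : (forall i, bnd_meas (h i)) ->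
  bnd_meas (fun w => \prod_(i < n) h i w).
Proof.
move=> bh; elim: n => [|n IH].
  by under eq_fun do rewrite big_ord0; exact: bnd_meas_cst.
by under eq_fun do rewrite big_ord_recr/=; exact: bnd_measM.
Qed.

Lemma bnd_meas_sum n (h : nat -> T -> R) : (forall i, bnd_meas (h i)) ->
  bnd_meas (fun w => \sum_(i < n) h i w).
Proof.
move=> bh; elim: n => [|n IH].
  by under eq_fun do rewrite big_ord0; exact: bnd_meas_cst.
by under eq_fun do rewrite big_ord_recr/=; exact: bnd_measD.
Qed.

(** Passage from sets to bounded functions of [Z]: the identity is linear in the test function and
    stable under uniform limits. The whole line as test set shows that [c] equals [E g]. *)
Lemma expect_factor (g Z : T -> R) (c : R) : bnd_meas g -> measurable_fun setT Z ->
  (forall A, measurable A ->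
    E (fun w => g w * \1_A (Z w)) = c * E (fun w => \1_A (Z w))) ->
  forall f : R -> R, measurable_fun setT f -> (exists M : R, forall x, `|f x| <= M) ->
    E (fun w => g w * f (Z w)) = c * E (fun w => f (Z w)).
Proof.
move=> bg mZ H f mf [M fM]; have [mg [G gG]] := bg.
have G0 : 0 <= G by rewrite (le_trans _ (gG point)).
apply/eqP; rewrite -subr_eq0 -normr_le0; apply/ler_addgt0Pr => e' e'0; rewrite add0r.
pose e := e' / (G + `|c| + 1).
have D0 : 0 < G + `|c| + 1 by have := normr_ge0 c; lra.
have e0 : 0 < e by rewrite divr_gt0.
have [n [A [mA fA]]] := bounded_simple_approx mf fM e0.
have bI i : bnd_meas (fun w => \1_(A i) (Z w) : R) by exact: bnd_meas_indic_comp.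
pose f' w : R := - M + e * \sum_(i < n) \1_(A i) (Z w).
have bs m : bnd_meas (fun w => \sum_(i < m) \1_(A i) (Z w) : R).
  exact: (@bnd_meas_sum m (fun i w => \1_(A i) (Z w))).
have bf' : bnd_meas f'.
  by apply: bnd_measD; [exact: bnd_meas_cst|apply: bnd_measM => //; exact: bnd_meas_cst].
have bf : bnd_meas (fun w => f (Z w)) by apply: bnd_meas_mcomp => //; exists M.
have Hs m : E (fun w => g w * \sum_(i < m) \1_(A i) (Z w)) =
    c * E (fun w => \sum_(i < m) \1_(A i) (Z w)).
  elim: m => [|m IH].
    under eq_fun do rewrite big_ord0 mulr0.
    by under [in RHS]eq_fun do rewrite big_ord0; rewrite !expect_cst mulr0.
  under eq_fun do rewrite big_ord_recr/= mulrDr.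
  under [in RHS]eq_fun do rewrite big_ord_recr/=.
  rewrite !expectD ?mulrDr ?IH ?H//;
    apply: bnd_meas_int; first [exact: bs | exact: bI
    | exact: (bnd_measM bg (bs _)) | exact: (bnd_measM bg (bI _))].
have Ec : E g = c.
  have := H setT measurableT; rewrite indicT expect_cst mulr1 => <-.
  by under [in RHS]eq_fun do rewrite /cst/= mulr1.
have Hf' : E (fun w => g w * f' w) = c * E f'.
  rewrite /f' (_ : (fun w => g w * _) = (fun w => - M * g w +
      e * (g w * \sum_(i < n) \1_(A i) (Z w)))); last by apply/funext => w; ring.
  have i1 : int_fun P (fun w => \sum_(i < n) \1_(A i) (Z w)) by exact: bnd_meas_int.
  have i2 : int_fun P (fun w => g w * \sum_(i < n) \1_(A i) (Z w)).
    exact/bnd_meas_int/bnd_measM.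
  rewrite expectD; [|exact/int_funZ/bnd_meas_int|exact: int_funZ].
  rewrite expectD; [|exact: int_fun_cst|exact: int_funZ].
  rewrite expect_cst (expectZ _ (bnd_meas_int P bg)) (expectZ e i1) (expectZ e i2) Hs Ec.
  by ring.
have -> : E (fun w => g w * f (Z w)) - c * E (fun w => f (Z w)) =
   (E (fun w => g w * f (Z w)) - E (fun w => g w * f' w)) -
   c * (E (fun w => f (Z w)) - E f') by rewrite Hf'; ring.
have h1 : `|E (fun w => g w * f (Z w)) - E (fun w => g w * f' w)| <= G * e.
  rewrite -[G * e](expect_cst P); apply: expectB_norm_le.
  - exact/bnd_meas_int/bnd_measM.
  - exact/bnd_meas_int/bnd_measM.
  - exact: int_fun_cst.
  - by move=> w; rewrite -mulrBr normrM ler_pM.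
have h2 : `|E (fun w => f (Z w)) - E f'| <= e.
  rewrite -[leRHS](expect_cst P); apply: expectB_norm_le => //.
  - exact/bnd_meas_int.
  - exact/bnd_meas_int.
  - exact: int_fun_cst.
rewrite (le_trans (ler_normB _ _))// normrM.
have -> : e' = (G + `|c| + 1) * e by rewrite /e; field; rewrite gt_eqF.
have := ler_wpM2l (normr_ge0 c) h2; lra.
Qed.

Variable X : nat -> T -> R.
Hypothesis mX : forall i, measurable_fun setT (X i).

(** Independence of [g] from [X k, X k.+1, ...], in a form linear in [g]: sums and differences
    arising from addition formulas keep the property. *)
Definition indep_from (k : nat) (g : T -> R) : Prop :=
  forall n (A : nat -> set R), (forall i, measurable (A i)) ->
    E (fun w => g w * \prod_(i < n) \1_(A (k + i)%N) (X (k + i)%N w)) =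
    E g * \prod_(i < n) E (fun w => \1_(A (k + i)%N) (X (k + i)%N w)).

(** One more variable is absorbed into [g]: with the later cylinder held fixed, the factorisation
    holds for every indicator of [X k], hence for every bounded function of it. *)
Lemma indep_from_step k g (f : R -> R) : bnd_meas g -> indep_from k g ->
  measurable_fun setT f -> (exists M : R, forall x, `|f x| <= M) ->
  indep_from k.+1 (fun w => g w * f (X k w)) /\
  E (fun w => g w * f (X k w)) = E g * E (fun w => f (X k w)).
Proof.
move=> bg Ig mf bf.
have H n (A : nat -> set R) : (forall i, measurable (A i)) ->
    E (fun w => g w * f (X k w) * \prod_(i < n) \1_(A (k.+1 + i)%N) (X (k.+1 + i)%N w)) =
    E g * \prod_(i < n) E (fun w => \1_(A (k.+1 + i)%N) (X (k.+1 + i)%N w)) *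
      E (fun w => f (X k w)).
  move=> mA.
  rewrite (_ : (fun w => _) = (fun w => g w * \prod_(i < n) \1_(A (k.+1 + i)%N)
      (X (k.+1 + i)%N w) * f (X k w))); last by apply/funext => w; ring.
  apply: (expect_factor _ (mX k)) => //.
    apply: bnd_measM => //.
    apply: (@bnd_meas_prod n (fun i w => \1_(A (k.+1 + i)%N) (X (k.+1 + i)%N w))) => i.
    exact: bnd_meas_indic_comp.
  move=> B mB.
  (* An arbitrary set in slot [k], the given cylinder in the later ones. *)
  pose A' i := if i == k then B else A i.
  have mA' i : measurable (A' i) by rewrite /A'; case: ifP.
  have A'k : A' (k + 0)%N = B by rewrite addn0 /A' eqxx.
  have A'S i : A' (k + i.+1)%N = A (k.+1 + i)%N.
    by rewrite /A' -addSnnS gtn_eqF// ltn_addr.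
  have := Ig n.+1 A' mA'.
  under eq_fun do rewrite big_ord_recl/= A'k addn0.
  rewrite big_ord_recl/= A'k addn0.
  under eq_fun do under eq_bigr do rewrite /bump/= add1n A'S -addSnnS.
  under [in RHS]eq_bigr do rewrite /bump/= add1n A'S -addSnnS.
  move=> H; rewrite -mulrA (mulrC (\prod_(i < n) _)) -H.
  by congr Rintegral; apply/funext => w; ring.
have E0 : E (fun w => g w * f (X k w)) = E g * E (fun w => f (X k w)).
  have := H 0%N (fun=> set0) (fun=> measurable0).
  by under eq_fun do rewrite big_ord0 mulr1; rewrite big_ord0 mulr1.
split => // n A mA; rewrite H// E0; ring.
Qed.

Lemma indep_fromD k g h : bnd_meas g -> bnd_meas h -> indep_from k g ->
  indep_from k h -> indep_from k (fun w => g w + h w).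
Proof.
move=> bg bh Ig Ih n A mA.
have bp : bnd_meas (fun w => \prod_(i < n) \1_(A (k + i)%N) (X (k + i)%N w) : R).
  apply: (@bnd_meas_prod n (fun i w => \1_(A (k + i)%N) (X (k + i)%N w))) => i.
  exact: bnd_meas_indic_comp.
under eq_fun do rewrite mulrDl.
rewrite !expectD ?Ig ?Ih ?mulrDl//.
all: by apply: bnd_meas_int => //; exact: bnd_measM.
Qed.

Lemma indep_fromB k g h : bnd_meas g -> bnd_meas h -> indep_from k g ->
  indep_from k h -> indep_from k (fun w => g w - h w).
Proof.
move=> bg bh Ig Ih n A mA.
have bp : bnd_meas (fun w => \prod_(i < n) \1_(A (k + i)%N) (X (k + i)%N w) : R).
  apply: (@bnd_meas_prod n (fun i w => \1_(A (k + i)%N) (X (k + i)%N w))) => i.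
  exact: bnd_meas_indic_comp.
under eq_fun do rewrite mulrBl.
rewrite !expectB ?Ig ?Ih ?mulrBl//.
all: by apply: bnd_meas_int => //; exact: bnd_measM.
Qed.

End independence.

(** * Characteristic functions of partial sums and conditioning on a random index *)

Section characteristic_functions.
Context {R : realType} {d : measure_display} {T : measurableType d}.
Variables (P : probability T R) (X : nat -> T -> R).
Hypothesis mX : forall i, measurable_fun setT (X i).

Local Notation E f := (Rintegral P setT f).

(** Starting point of the inductions over partial sums: [D] is the whole space when a fixed sum is
    studied, and a level set of the random index when conditioning. *)
Lemma indep_from0_indic (D : set T) : mutually_independent P X -> measurable D ->
  (forall (s : seq nat) (A : nat -> set R), (forall i, measurable (A i)) ->
    P (D `&` \bigcap_(i in [set` s]) (X i @^-1` A i)) =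
    (P D * P (\bigcap_(i in [set` s]) (X i @^-1` A i)))%E) ->
  indep_from P X 0 \1_D.
Proof.
move=> iX mD iD n A mA.
pose I := \bigcap_(i in [set` iota 0 n]) (X i @^-1` A i).
have mXA i : measurable (X i @^-1` A i) by rewrite -[X in measurable X]setTI; exact: mX.
have mI : measurable I by apply: fin_bigcap_measurable => //; exact: finite_seq.
have -> : (fun w => \1_D w * \prod_(i < n) \1_(A (0 + i)%N) (X (0 + i)%N w)) =
    \1_(D `&` I) :> (T -> R).
  apply/funext => w; rewrite indicI /=; congr (_ * _).
  rewrite [RHS]indicE; case: (boolP (w \in I)) => [/set_mem wI|wI].
    apply: big1 => i _; rewrite add0n indicE mem_set//; apply: wI.
    by rewrite /= mem_iota add0n ltn_ord.
  have [i nA] : exists i : 'I_n, ~ A i (X i w).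
    apply: contrapT => nex; apply: (negP wI); apply/mem_set => j /=.
    rewrite mem_iota add0n => /= jn; apply: contrapT => nA.
    by apply: nex; exists (Ordinal jn).
  by rewrite (bigD1 i)//= add0n indicE memNset// mul0r.
rewrite expect_indic; last exact: measurableI.
rewrite iD// fineM ?fin_num_measure// -expect_indic//; congr (_ * _).
rewrite /I iX ?iota_uniq// -[X in iota _ X](subn0 n) big_mkord.
elim: (n) => [|m IH]; first by rewrite !big_ord0.
rewrite !big_ord_recr/= fineM ?IH ?fin_num_measure//; last first.
  by apply: prode_fin_num => i _; rewrite fin_num_measure.
by congr (_ * _); rewrite add0n -expect_indic.
Qed.

(* Real and imaginary parts of the characteristic function of a sum of [k]
   independent terms, from those of the terms. *)
Fixpoint char_prod (C S : nat -> R) (k : nat) : R * R :=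
  if k is k'.+1 then
    let: (c, s) := char_prod C S k' in
    (c * C k' - s * S k', s * C k' + c * S k')
  else (1, 0).

Definition char_sum u := char_prod (fun i => E (fun w => cos (u * X i w)))
  (fun i => E (fun w => sin (u * X i w))).

Lemma measurable_partial_sum k : measurable_fun setT (fun w => \sum_(i < k) X i w).
Proof. exact: measurable_sum. Qed.

Lemma continuous_cosM u : continuous (fun x : R => cos (u * x)).
Proof.
move=> x; apply: continuous_comp; last exact: continuous_cos.
by apply: cvgMr; exact: cvg_id.
Qed.

Lemma continuous_sinM u : continuous (fun x : R => sin (u * x)).
Proof.
move=> x; apply: continuous_comp; last exact: continuous_sin.
by apply: cvgMr; exact: cvg_id.
Qed.

Lemma bnd_meas_cos (Y : T -> R) u : measurable_fun setT Y ->
  bnd_meas (fun w => cos (u * Y w)).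
Proof.
move=> mY; apply: (@bnd_meas_comp _ _ _ (fun x => cos (u * x))) => //.
  exact: continuous_cosM.
by exists 1 => x; exact: cos_max.
Qed.

Lemma bnd_meas_sin (Y : T -> R) u : measurable_fun setT Y ->
  bnd_meas (fun w => sin (u * Y w)).
Proof.
move=> mY; apply: (@bnd_meas_comp _ _ _ (fun x => sin (u * x))) => //.
  exact: continuous_sinM.
by exists 1 => x; exact: sin_max.
Qed.

(** Cosine and sine must be carried along together: the addition formulas mix them, and reproduce
    the complex multiplication in [char_prod]. The independence clauses are the induction
    invariant. *)
Lemma expect_char_sum_aux u k g : bnd_meas g -> indep_from P X 0 g ->
  [/\ indep_from P X k (fun w => g w * cos (u * \sum_(i < k) X i w)),
      indep_from P X k (fun w => g w * sin (u * \sum_(i < k) X i w)),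
      E (fun w => g w * cos (u * \sum_(i < k) X i w)) = E g * (char_sum u k).1 &
      E (fun w => g w * sin (u * \sum_(i < k) X i w)) = E g * (char_sum u k).2].
Proof.
move=> bg Ig; elim: k => [|k [Ic Is Ec Es]].
  rewrite (_ : (fun w => _ * cos _) = g); last first.
    by apply/funext => w; rewrite big_ord0 mulr0 cos0 mulr1.
  (* Zero is written as [g - g] so that its independence follows from stability under
     differences. *)
  rewrite (_ : (fun w => _ * sin _) = (fun w => g w - g w)); last first.
    by apply/funext => w; rewrite big_ord0 mulr0 sin0 mulr0 subrr.
  split => //=; rewrite ?mulr1//; first exact: indep_fromB.
  by rewrite expectB ?subrr ?mulr0//; exact: bnd_meas_int.
pose S w := \sum_(i < k) X i w.
have mS := measurable_partial_sum k.
have bc : bnd_meas (fun w => g w * cos (u * S w)) by apply: bnd_measM => //; exact: bnd_meas_cos.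
have bs : bnd_meas (fun w => g w * sin (u * S w)) by apply: bnd_measM => //; exact: bnd_meas_sin.
have bcX : bnd_meas (fun w => cos (u * X k w)) by exact: bnd_meas_cos.
have bsX : bnd_meas (fun w => sin (u * X k w)) by exact: bnd_meas_sin.
have mc := continuous_measurable_fun (@continuous_cosM u).
have ms := continuous_measurable_fun (@continuous_sinM u).
have bdc : exists M : R, forall x : R, `|cos (u * x)| <= M by exists 1 => x; exact: cos_max.
have bds : exists M : R, forall x : R, `|sin (u * x)| <= M by exists 1 => x; exact: sin_max.
have [Jcc Ecc] := indep_from_step mX bc Ic mc bdc.
have [Jcs Ecs] := indep_from_step mX bc Ic ms bds.
have [Jsc Esc] := indep_from_step mX bs Is mc bdc.
have [Jss Ess] := indep_from_step mX bs Is ms bds.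
rewrite (_ : (fun w => g w * cos _) = (fun w => g w * cos (u * S w) * cos (u * X k w) -
    g w * sin (u * S w) * sin (u * X k w))); last first.
  by apply/funext => w; rewrite big_ord_recr/= mulrDr cosD /S; ring.
rewrite (_ : (fun w => g w * sin _) = (fun w => g w * sin (u * S w) * cos (u * X k w) +
    g w * cos (u * S w) * sin (u * X k w))); last first.
  by apply/funext => w; rewrite big_ord_recr/= mulrDr sinD /S; ring.
have bcc := bnd_measM bc bcX; have bcs := bnd_measM bc bsX.
have bsc := bnd_measM bs bcX; have bss := bnd_measM bs bsX.
rewrite expectB; [|exact: bnd_meas_int..].
rewrite expectD; [|exact: bnd_meas_int..].
rewrite Ecc Ecs Esc Ess Ec Es /char_sum/=; case: char_prod => c s /=.
by split; [exact: indep_fromB|exact: indep_fromD|ring|ring].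
Qed.

Lemma sum_indic_level (N : T -> nat) n (h : nat -> R) w :
  \sum_(m < n) \1_[set w | N w = m] w * h m = if (N w < n)%N then h (N w) else 0.
Proof.
elim: n => [|n IH]; first by rewrite big_ord0.
rewrite big_ord_recr/= IH indicE; have [Nn|Nn|Nn] := ltngtP (N w) n.
- rewrite memNset /=; last by move=> Nwn; rewrite Nwn ltnn in Nn.
  by rewrite mul0r addr0 ltnS (ltnW Nn).
- rewrite memNset /=; last by move=> Nwn; rewrite Nwn ltnn in Nn.
  by rewrite mul0r addr0 ltnS leqNgt Nn.
- by rewrite mem_set// mul1r add0r Nn ltnS leqnn.
Qed.

Lemma measurable_random_index (N : T -> nat) (F : nat -> T -> R) :
  (forall k, measurable [set w | N w = k]) ->
  (forall k, measurable_fun setT (F k)) -> measurable_fun setT (fun w => F (N w) w).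
Proof.
move=> mN mF _ Y mY; rewrite setTI.
have -> : (fun w => F (N w) w) @^-1` Y =
    \bigcup_k ([set w | N w = k] `&` F k @^-1` Y).
  apply/seteqP; split => [w /= FY|w [k _ [/= <-]]//].
  by exists (N w).
apply: bigcupT_measurable => k; apply: measurableI => //.
by rewrite -[X in measurable X]setTI; exact: mF.
Qed.

(** Total expectation over the level sets of [N]. Finitely many levels contribute nothing to the
    difference, and the remaining event [n <= N] has vanishing probability while the integrands stay
    bounded by [M]. *)
Lemma expect_random_index (N : T -> nat) (F G : nat -> T -> R) (M : R) :
  (forall k, measurable [set w | N w = k]) ->
  (forall k, measurable_fun setT (F k)) -> (forall k, measurable_fun setT (G k)) ->
  (forall k w, `|F k w| <= M) -> (forall k w, `|G k w| <= M) ->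
  (forall k, E (fun w => \1_[set w | N w = k] w * F k w) =
             E (fun w => \1_[set w | N w = k] w * G k w)) ->
  E (fun w => F (N w) w) = E (fun w => G (N w) w).
Proof.
move=> mN mF mG FM GM FG.
have bF k : bnd_meas (F k) by split => //; exists M.
have bG k : bnd_meas (G k) by split => //; exists M.
have bI k : bnd_meas (\1_[set w | N w = k] : T -> R) by exact: bnd_meas_indic.
have bFN : bnd_meas (fun w => F (N w) w).
  by split; [exact: measurable_random_index|exists M].
have bGN : bnd_meas (fun w => G (N w) w).
  by split; [exact: measurable_random_index|exists M].
have M0 : 0 <= M by rewrite (le_trans _ (FM 0%N point)).
apply/eqP; rewrite -subr_eq0 -normr_le0; apply/ler_addgt0Pr => e e0; rewrite add0r.
pose A n := [set w | (n <= N w)%N].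
have mA n : measurable (A n).
  have -> : A n = \bigcup_(k in [set k | (n <= k)%N]) [set w | N w = k].
    apply/seteqP; split => [w /= nN|w [k /= nk Nk]]; first by exists (N w).
    by rewrite /A/= Nk.
  exact: bigcup_measurable.
have /cvgrPdist_le : fine (P (A n)) @[n --> \oo] --> (0 : R).
  apply: fineP_cvg0 => //; first by move=> n w; exact: ltnW.
  by move=> w; exists (N w).+1; rewrite /A/= ltnn.
have eM0 : 0 < e / (2 * M + 1) by rewrite divr_gt0//; lra.
move=> /(_ _ eM0)[n _ /(_ n (leqnn n))].
rewrite sub0r normrN ger0_norm ?fineP_ge0// => An.
have Es m : E (fun w => \sum_(k < m) \1_[set w | N w = k] w * (F k w - G k w)) = 0.
  elim: m => [|m IH].
    by under eq_fun do rewrite big_ord0; rewrite expect_cst.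
  under eq_fun do rewrite big_ord_recr/= mulrBr.
  have bh k : bnd_meas (fun w => \1_[set w | N w = k] w * (F k w - G k w)).
    by apply: bnd_measM => //; exact: bnd_measB.
  rewrite expectD ?IH ?expectB ?FG ?subrr ?addr0//.
  - exact/bnd_meas_int/bnd_measM.
  - exact/bnd_meas_int/bnd_measM.
  - exact/bnd_meas_int/(bnd_meas_sum m bh).
  - by apply: int_funB; exact/bnd_meas_int/bnd_measM.
have bD : bnd_meas (fun w => F (N w) w - G (N w) w) by exact: bnd_measB.
rewrite -expectB; [|exact: bnd_meas_int..].
rewrite -[X in `|X|]subr0 -(Es n).
apply: (@le_trans _ _ (E (fun w => 2 * M * \1_(A n) w))); last first.
  rewrite (expectZ _ (bnd_meas_int P (bnd_meas_indic (mA n)))) expect_indic//.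
  have -> : e = (2 * M + 1) * (e / (2 * M + 1)) by field; lra.
  apply: (@le_trans _ _ (2 * M * (e / (2 * M + 1)))).
    by rewrite ler_wpM2l// mulr_ge0.
  by rewrite ler_wpM2r ?(ltW eM0)//; lra.
apply: expectB_norm_le.
- exact: bnd_meas_int.
- apply: bnd_meas_int.
  apply: (@bnd_meas_sum _ _ _ n (fun k w => \1_[set w | N w = k] w * (F k w - G k w))) => k.
  by apply: bnd_measM => //; exact: bnd_measB.
- exact/int_funZ/bnd_meas_int/bnd_meas_indic.
move=> w; rewrite (sum_indic_level N n (fun k => F k w - G k w)).
have [Nn|Nn] := ltnP (N w) n.
  by rewrite subrr normr0 mulr_ge0// mulr_ge0.
rewrite subr0 indicE mem_set// mulr1 (le_trans (ler_normB _ _))//.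
by have := FM (N w) w; have := GM (N w) w; lra.
Qed.

End characteristic_functions.

(** * Taylor estimates for the characteristic function of one centred variable *)

Section second_moments.
Context {R : realType} {d : measure_display} {T : measurableType d}.
Variable P : probability T R.

Local Notation E f := (Rintegral P setT f).

Lemma centered_Lfun2 (Z : T -> R) (s2 : R) : Z \in Lfun P 2%:E ->
  ('E_P[Z] = 0)%E -> variance P Z = s2%:E ->
  [/\ int_fun P Z, int_fun P (fun w => Z w ^+ 2), E Z = 0 & E (fun w => Z w ^+ 2) = s2].
Proof.
move=> Z2 EZ VZ.
have Z1 : Z \in Lfun P 1 by apply: Lfun_subset12 => //; rewrite fin_num_measure.
split.
- exact/Lfun1_integrable.
- exact: Lfun2_integrable_sqr.
- by move: EZ; rewrite unlock /Rintegral => ->.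
- move: VZ; rewrite varianceE// EZ expe2 mul0e sube0 unlock /Rintegral => EZ2.
  by rewrite (_ : s2 = fine s2%:E)// -EZ2.
Qed.

Variables (Z : T -> R) (s2 : R).
Hypothesis iZ : int_fun P Z.
Hypothesis iZ2 : int_fun P (fun w => Z w ^+ 2).
Hypothesis EZ : E Z = 0.
Hypothesis EZ2 : E (fun w => Z w ^+ 2) = s2.

Let mZ : measurable_fun setT Z := int_fun_meas iZ.

(** The truncated second moment of the Lindeberg condition, with an indicator in place of a
    restricted domain so that the rules for expectations apply. *)
Definition tail2 (th : R) := E (fun w => \1_[set w | th <= `|Z w|] w * Z w ^+ 2).

Lemma measurable_norm_ge th : measurable [set w | th <= `|Z w|].
Proof.
have := measurable_fun_ler (@measurable_cst _ _ T _ setT th)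
  (measurableT_comp (@normr_measurable R setT) mZ).
by move=> /(_ measurableT [set true]); rewrite setTI; apply.
Qed.

Let bI th : bnd_meas (\1_[set w | th <= `|Z w|] : T -> R).
Proof. exact/bnd_meas_indic/measurable_norm_ge. Qed.

Lemma tail2E th :
  tail2 th = fine (\int[P]_(w in [set w | (th <= `|Z w|)%R]) ((Z w) ^+ 2)%:E)%E.
Proof.
rewrite /tail2 -[RHS]/(Rintegral P _ (fun w => Z w ^+ 2)) [RHS]Rintegral_mkcond.
apply: eq_Rintegral => w _; rewrite patchE indicE.
by case: ifPn => [_|_]; rewrite ?mul1r ?mul0r.
Qed.

Lemma tail2_ge0 th : 0 <= tail2 th.
Proof.
by apply: expect_ge0 => w; rewrite mulr_ge0 ?sqr_ge0.
Qed.

(** Source of uniform negligibility: with [th = tau B_k], no single variance exceeds a small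
    fraction of [B_k^2]. *)
Lemma var_le_tail2 th : 0 <= th -> s2 <= th ^+ 2 + tail2 th.
Proof.
move=> th0; have i1 := int_funM (bI th) iZ2.
rewrite -EZ2 -[X in X + _](expect_cst P) -expectD//; last exact: int_fun_cst.
apply: le_expect => //; first by apply: int_funD => //; exact: int_fun_cst.
move=> w; have [thZ|Zth] := leP th `|Z w|.
  by rewrite indicE mem_set// mul1r lerDr sqr_ge0.
have := sqr_ge0 (Z w) => z0.
apply: (@le_trans _ _ (th ^+ 2)).
  by rewrite -(real_normK (num_real (Z w))) ler_sqr ?nnegrE// ltW.
by rewrite lerDl mulr_ge0// indicE; case: (_ \in _).
Qed.

(** Centring allows [u Z] to be subtracted from the sine at no cost. The dominating [D] may use the
    quadratic bound at some points and the cubic one at others. *)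
Lemma trig_moment_bounds (D : T -> R) u : int_fun P D ->
  (forall w, (u * Z w) ^+ 2 <= D w \/ `|u * Z w| ^+ 3 <= D w) ->
  `|E (fun w => sin (u * Z w))| <= E D /\
  `|E (fun w => cos (u * Z w)) - (1 - u ^+ 2 * s2 / 2)| <= E D.
Proof.
move=> iD DP.
have ic : int_fun P (fun w => cos (u * Z w)) by exact/bnd_meas_int/bnd_meas_cos.
have is' : int_fun P (fun w => sin (u * Z w)) by exact/bnd_meas_int/bnd_meas_sin.
split.
  have -> : E (fun w => sin (u * Z w)) = E (fun w => sin (u * Z w)) - E (fun w => u * Z w).
    by rewrite expectZ// EZ mulr0 subr0.
  apply: expectB_norm_le => //; first exact: int_funZ.
  move=> w; have [h1 h2] := sin_linear_approx (u * Z w).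
  by case: (DP w); exact: le_trans.
have i1 : int_fun P (fun w => u ^+ 2 / 2 * Z w ^+ 2) by exact: int_funZ.
have -> : 1 - u ^+ 2 * s2 / 2 = E (fun w => 1 - u ^+ 2 / 2 * Z w ^+ 2).
  rewrite expectB//; last exact: int_fun_cst.
  by rewrite expect_cst expectZ// EZ2; ring.
apply: expectB_norm_le => //; first by apply: int_funB => //; exact: int_fun_cst.
move=> w; have [h1 h2] := cos_quadratic_approx (u * Z w).
have -> : cos (u * Z w) - (1 - u ^+ 2 / 2 * Z w ^+ 2) =
  cos (u * Z w) - 1 + (u * Z w) ^+ 2 / 2 by field.
by case: (DP w); exact: le_trans.
Qed.

Lemma trig_moment_quadratic u :
  `|E (fun w => sin (u * Z w))| <= u ^+ 2 * s2 /\
  `|E (fun w => cos (u * Z w)) - (1 - u ^+ 2 * s2 / 2)| <= u ^+ 2 * s2.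
Proof.
have -> : u ^+ 2 * s2 = E (fun w => u ^+ 2 * Z w ^+ 2) by rewrite expectZ// EZ2.
(* Restores only the occurrence inside [1 - u ^+ 2 * s2 / 2]. *)
rewrite {2}(_ : E (fun w => u ^+ 2 * Z w ^+ 2) = u ^+ 2 * s2); last by rewrite expectZ// EZ2.
apply: trig_moment_bounds; first exact: int_funZ.
by move=> w; left; rewrite exprMn.
Qed.

(** Quadratic bound on [th <= |Z|]. Below the threshold the cubic bound gives
    [|u Z|^3 <= |u| th (u Z)^2]. *)
Lemma trig_moment_lindeberg u th : 0 <= th ->
  `|E (fun w => sin (u * Z w))| <= `|u| * th * (u ^+ 2 * s2) + u ^+ 2 * tail2 th /\
  `|E (fun w => cos (u * Z w)) - (1 - u ^+ 2 * s2 / 2)| <=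
     `|u| * th * (u ^+ 2 * s2) + u ^+ 2 * tail2 th.
Proof.
move=> th0.
have i1 := int_funM (bI th) iZ2.
pose D w := `|u| * th * u ^+ 2 * Z w ^+ 2 +
  u ^+ 2 * (\1_[set w | th <= `|Z w|] w * Z w ^+ 2).
have ED : E D = `|u| * th * (u ^+ 2 * s2) + u ^+ 2 * tail2 th.
  rewrite /D expectD ?expectZ ?EZ2 ?mulrA//; exact: int_funZ.
rewrite -ED; apply: trig_moment_bounds.
  by apply: int_funD; exact: int_funZ.
move=> w; rewrite /D; have := sqr_ge0 (Z w) => z0.
have p0 : 0 <= `|u| * th * u ^+ 2 * Z w ^+ 2.
  by rewrite mulr_ge0 ?sqr_ge0// mulr_ge0 ?sqr_ge0// mulr_ge0.
have [thZ|Zth] := leP th `|Z w|.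
  by left; rewrite indicE mem_set// mul1r exprMn lerDr.
right; rewrite indicE memNset /=; last by rewrite leNgt Zth.
rewrite mul0r mulr0 addr0 normrM exprMn -(real_normK (num_real u)).
rewrite -(real_normK (num_real (Z w))).
have -> : `|u| ^+ 3 * `|Z w| ^+ 3 = (`|u| ^+ 3 * `|Z w| ^+ 2) * `|Z w| by ring.
have -> : `|u| * th * `|u| ^+ 2 * `|Z w| ^+ 2 = (`|u| ^+ 3 * `|Z w| ^+ 2) * th by ring.
by rewrite ler_wpM2l ?(ltW Zth)// mulr_ge0// exprn_ge0.
Qed.

End second_moments.

(** * Comparison of products of characteristic functions *)

Section char_prod_bounds.
Context {R : realType}.

(** Telescoping comparison of products with factors bounded by 1. Sine parts are treated as
    perturbations. The partial products are assumed bounded by 1, which holds in the applications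
    because they are expectations of a cosine and a sine. *)
Lemma char_prod_approx (C S e : nat -> R) k : (forall i, 0 <= e i <= 1) ->
  (forall i, `|C i| <= 1) ->
  (forall i, `|(char_prod C S i).1| <= 1 /\ `|(char_prod C S i).2| <= 1) ->
  `|(char_prod C S k).1 - \prod_(i < k) e i| <= \sum_(i < k) (`|C i - e i| + `|S i|) /\
  `|(char_prod C S k).2| <= \sum_(i < k) `|S i|.
Proof.
move=> e01 C1 cs1; elim: k => [|k]; first by rewrite !big_ord0 /= subrr normr0.
rewrite !big_ord_recr/=; have := cs1 k; case: char_prod => c s /= [c1 s1] [IHc IHs].
have /andP[e0 e1] := e01 k; split.
  have -> : c * C k - s * S k - \prod_(i < k) e i * e k =
    (c - \prod_(i < k) e i) * e k + (c * (C k - e k) - s * S k) by ring.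
  rewrite (le_trans (ler_normD _ _))// lerD//.
    by rewrite normrM (ger0_norm e0) (le_trans _ IHc)// ler_piMr.
  rewrite (le_trans (ler_normB _ _))// lerD// normrM ler_piMl//.
rewrite (le_trans (ler_normD _ _))// lerD//.
  by rewrite normrM (le_trans _ IHs)// ler_piMr.
by rewrite normrM ler_piMl.
Qed.

End char_prod_bounds.

(** * Gaussian approximation of partial sums under the Lindeberg condition *)

Section lindeberg.
Context {R : realType} {d : measure_display} {T : measurableType d}.
Variables (P : probability T R) (X : nat -> T -> R) (sigma2 : nat -> R).

Local Notation E f := (Rintegral P setT f).

Hypothesis mX : forall i, measurable_fun setT (X i).
Hypothesis indepX : mutually_independent P X.
Hypothesis iX : forall i, int_fun P (X i).
Hypothesis iX2 : forall i, int_fun P (fun w => X i w ^+ 2).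
Hypothesis EX : forall i, E (X i) = 0.
Hypothesis EX2 : forall i, E (fun w => X i w ^+ 2) = sigma2 i.
Hypothesis sigma2_gt0 : forall i, 0 < sigma2 i.

Let V k := \sum_(i < k) sigma2 i.

Lemma V_ge0 k : 0 <= V k.
Proof. by apply: sumr_ge0 => i _; exact: ltW. Qed.

Lemma V_gt0 k : (0 < k)%N -> 0 < V k.
Proof.
by case: k => // k _; rewrite /V big_ord_recr/= ltr_wpDl// V_ge0.
Qed.

Lemma char_sum_expect u k :
  (char_sum P X u k).1 = E (fun w => cos (u * \sum_(i < k) X i w)) /\
  (char_sum P X u k).2 = E (fun w => sin (u * \sum_(i < k) X i w)).
Proof.
have I0 : indep_from P X 0 \1_[set: T].
  apply: indep_from0_indic => // s A mA.
  by rewrite setTI probability_setT mul1e.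
have [_ _] := expect_char_sum_aux mX u k (bnd_meas_indic measurableT) I0.
rewrite indicT expect_cst !mul1r => <- <-.
by split; congr Rintegral; apply/funext => w; rewrite /cst/= mul1r.
Qed.

Lemma expect_norm_le1 (f : T -> R) : bnd_meas f -> (forall w, `|f w| <= 1) -> `|E f| <= 1.
Proof.
move=> bf f1; rewrite -[leRHS](expect_cst P); apply: norm_expect_le => //.
  exact: bnd_meas_int.
exact: int_fun_cst.
Qed.

Lemma char_sum_le1 u k : `|(char_sum P X u k).1| <= 1 /\ `|(char_sum P X u k).2| <= 1.
Proof.
have [-> ->] := char_sum_expect u k; have mS := measurable_partial_sum mX k.
split; apply: expect_norm_le1.
- exact: (bnd_meas_cos u mS).
- by move=> w; exact: cos_max.
- exact: (bnd_meas_sin u mS).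
- by move=> w; exact: sin_max.
Qed.

Let C_le1 u i : `|E (fun w => cos (u * X i w))| <= 1.
Proof.
by apply: expect_norm_le1; [exact: bnd_meas_cos|move=> w; exact: cos_max].
Qed.

(** Comparison with the product of ones, valid for every [k] and [u]. Each factor contributes at
    most [2 u^2 sigma_i^2] through its cosine and [u^2 sigma_i^2] through its sine, hence the 3. *)
Lemma char_sum_quadratic u k : `|1 - (char_sum P X u k).1| <= 3 * (u ^+ 2 * V k).
Proof.
have [] := @char_prod_approx R (fun i => E (fun w => cos (u * X i w)))
  (fun i => E (fun w => sin (u * X i w))) (fun=> 1) k.
- by move=> i; rewrite ler01 lexx.
- exact: C_le1.
- exact: char_sum_le1.
rewrite big1// distrC => H _; apply: (le_trans H).
rewrite /V !mulr_sumr; apply: ler_sum => i _.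
have [h1 h2] := trig_moment_quadratic (iX i) (iX2 i) (EX i) (EX2 i) u.
have s0 : 0 <= u ^+ 2 * sigma2 i by rewrite mulr_ge0 ?sqr_ge0// ltW.
have h4 : `|E (fun w => cos (u * X i w)) - 1| <= 2 * (u ^+ 2 * sigma2 i).
  move: h2; rewrite !ler_norml.
  by move: (E _) s0; move: (u ^+ 2 * sigma2 i) => a c; lra.
by move: h4 h1; move: (`|_|) (`|_|) => a c; lra.
Qed.

Hypothesis lindeberg : forall tau : R, 0 < tau ->
  (fun k => (V k)^-1 * \sum_(i < k) tail2 P (X i) (tau * Num.sqrt (V k))) @ \oo --> (0 : R).

(** Each factor is compared with [exp (- u^2 sigma_i^2 / 2)], whose product is the Gaussian value.
    The summed errors depend on [u] only through [|u| B_k], whence the uniformity. *)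
Lemma char_sum_lindeberg (K e : R) : 0 < K -> 0 < e ->
  \forall k \near \oo, forall u, `|u| * Num.sqrt (V k) <= K ->
    `|(char_sum P X u k).1 - expR (- (u ^+ 2 * V k / 2))| <= e /\
    `|(char_sum P X u k).2| <= e.
Proof.
move=> K0 e0.
(* The total error is at most [tau * Q]: the Lindeberg errors [tau (K^3 + K^2)] occur for cosine and
   for sine, and [tau K^4] comes from linearising the exponentials, where [tau <= 1] is used to
   bound [tau^2]. *)
pose Q := 2 * (K ^+ 3 + K ^+ 2) + K ^+ 4.
have Q0 : 0 < Q.
  by have := exprn_gt0 2 K0; have := exprn_gt0 3 K0; have := exprn_gt0 4 K0; rewrite /Q; lra.
pose tau := Num.min 1 (e / Q).
have tau0 : 0 < tau by rewrite lt_min ltr01 divr_gt0.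
have tau1 : tau <= 1 by rewrite ge_min lexx.
have tauQ : tau * Q <= e by rewrite -ler_pdivlMr// ge_min lexx orbT.
near=> k => u uK.
have k0 : (0 < k)%N by near: k; exact: nbhs_infty_gt.
have Vk0 := V_gt0 k0.
set b := Num.sqrt (V k) in uK *.
have b0 : 0 < b by rewrite sqrtr_gt0.
have b2 : b ^+ 2 = V k by rewrite sqr_sqrtr// ltW.
pose L := (V k)^-1 * \sum_(i < k) tail2 P (X i) (tau * b).
have t0 i : 0 <= tail2 P (X i) (tau * b) by exact: tail2_ge0.
have L0 : 0 <= L by rewrite mulr_ge0 ?invr_ge0 ?(ltW Vk0)// sumr_ge0.
have Ltau : L <= tau.
  have : `|0 - L| <= tau.
    by rewrite /L /b; near: k; move/cvgrPdist_le : (lindeberg tau0); apply.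
  by rewrite sub0r normrN ger0_norm.
have sL : \sum_(i < k) tail2 P (X i) (tau * b) = V k * L.
  by rewrite /L mulrA divff ?mul1r// gt_eqF.
have u2V : u ^+ 2 * V k = (`|u| * b) ^+ 2.
  by rewrite exprMn b2 (real_normK (num_real u)).
set x := `|u| * b in uK u2V.
have x0 : 0 <= x by rewrite mulr_ge0// ltW.
have th0 : 0 <= tau * b by rewrite mulr_ge0// ltW.
pose D i := `|u| * (tau * b) * (u ^+ 2 * sigma2 i) + u ^+ 2 * tail2 P (X i) (tau * b).
have sD : \sum_(i < k) D i = tau * x ^+ 3 + x ^+ 2 * L.
  rewrite /D big_split/= -!mulr_sumr -/(V k) sL u2V.
  by rewrite mulrA u2V /x; ring.
have tD i : `|E (fun w => sin (u * X i w))| <= D i /\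
  `|E (fun w => cos (u * X i w)) - (1 - u ^+ 2 * sigma2 i / 2)| <= D i.
  exact: trig_moment_lindeberg (iX i) (iX2 i) (EX i) (EX2 i) u _ th0.
have s0 i : 0 <= u ^+ 2 * sigma2 i by rewrite mulr_ge0 ?sqr_ge0// ltW.
pose ei i := expR (- (u ^+ 2 * sigma2 i / 2)).
have [] := @char_prod_approx R (fun i => E (fun w => cos (u * X i w)))
  (fun i => E (fun w => sin (u * X i w))) ei k.
- move=> i; rewrite expR_ge0/= expR_le1.
  by have := s0 i; lra.
- exact: C_le1.
- exact: char_sum_le1.
have -> : \prod_(i < k) ei i = expR (- (u ^+ 2 * V k / 2)).
  rewrite /ei -expR_sum; congr expR.
  by rewrite /V mulr_sumr mulr_suml sumrN.
have Sle : \sum_(i < k) `|E (fun w => sin (u * X i w))| <= \sum_(i < k) D i.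
  by apply: ler_sum => i _; have [] := tD i.
have xK2 : x ^+ 2 <= K ^+ 2 by rewrite ler_sqr ?nnegrE// ltW.
have xK3 : x ^+ 3 <= K ^+ 3 by rewrite lerXn2r ?nnegrE// ltW.
have x20 := exprn_ge0 2 x0; have x30 := exprn_ge0 3 x0.
have sDK : \sum_(i < k) D i <= tau * (K ^+ 3 + K ^+ 2).
  rewrite sD mulrDr lerD//; first by rewrite ler_wpM2l// ltW.
  by rewrite mulrC ler_pM.
have K4 := exprn_gt0 4 K0.
move=> Hc Hs; split; last first.
  apply: (le_trans Hs); apply: (le_trans Sle); apply: (le_trans sDK).
  apply: (le_trans _ tauQ); rewrite ler_pM2l// /Q.
  by have := exprn_gt0 2 K0; have := exprn_gt0 3 K0; lra.
apply: (le_trans Hc); rewrite big_split/=.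
apply: (@le_trans _ _ (\sum_(i < k) (D i + (K ^+ 2 * (tau ^+ 2 + L)) / 2 * (u ^+ 2 * sigma2 i)) +
   \sum_(i < k) D i)).
  rewrite lerD//; apply: ler_sum => i _.
  have [_ h1] := tD i.
  have y0 : 0 <= u ^+ 2 * sigma2 i / 2 by have := s0 i; lra.
  have h2 := expRN_linear_approx y0; rewrite -/(ei i) in h2.
  have ti : tail2 P (X i) (tau * b) <= V k * L.
    rewrite -sL (bigD1 i)//= lerDl.
    by apply: sumr_ge0 => j _; exact: t0.
  have si : u ^+ 2 * sigma2 i <= K ^+ 2 * (tau ^+ 2 + L).
    apply: (@le_trans _ _ (u ^+ 2 * (V k * (tau ^+ 2 + L)))).
      rewrite ler_wpM2l ?sqr_ge0// (le_trans (var_le_tail2 (iX i) (iX2 i) (EX2 i) th0))//.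
      by rewrite exprMn b2 mulrDr mulrC lerD2l.
    by rewrite mulrA u2V ler_wpM2r// addr_ge0// sqr_ge0.
  (* One factor of the square is bounded uniformly in [i] by negligibility; the other is kept, to be
     summed to [u^2 B_k^2]. *)
  have h3 : (u ^+ 2 * sigma2 i / 2) ^+ 2 <= K ^+ 2 * (tau ^+ 2 + L) / 2 * (u ^+ 2 * sigma2 i).
    move: (s0 i) si; move: (u ^+ 2 * sigma2 i) (K ^+ 2 * _) => p q p0 pq; nra.
  have -> : E (fun w => cos (u * X i w)) - ei i =
    (E (fun w => cos (u * X i w)) - (1 - u ^+ 2 * sigma2 i / 2)) -
    (ei i - (1 - u ^+ 2 * sigma2 i / 2)) by ring.
  by rewrite (le_trans (ler_normB _ _))// lerD// (le_trans h2).
rewrite big_split/= -mulr_sumr -mulr_sumr -/(V k) u2V.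
apply: (le_trans _ tauQ).
have h : K ^+ 2 * (tau ^+ 2 + L) / 2 * x ^+ 2 <= tau * K ^+ 4.
  have -> : tau * K ^+ 4 = K ^+ 2 * (tau + tau) / 2 * K ^+ 2 by field.
  rewrite ler_pM//.
  - by rewrite !mulr_ge0 ?exprn_ge0 ?addr_ge0 ?sqr_ge0// ltW.
  - rewrite ler_pM2r// ler_pM2l ?exprn_gt0// lerD//.
    by rewrite expr2 ler_piMl// ltW.
rewrite /Q; move: h sDK; move: (\sum_(i < k) D i) => SD.
by lra.
Unshelve. all: by end_near. Qed.

End lindeberg.

(** * Continuity theorems for Laplace and Fourier transforms *)

Section continuity_theorems.
Context {R : realType} {d : measure_display} {T : measurableType d}.
Variable P : probability T R.
Implicit Types Y : nat -> T -> R.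

Local Notation E f := (Rintegral P setT f).

Lemma bnd_meas_Cb (f : R -> R) (Z : T -> R) : Cb f -> measurable_fun setT Z ->
  bnd_meas (fun w => f (Z w)).
Proof. by move=> [cf bf]; exact: bnd_meas_comp. Qed.

(** The limits form a tight functional: a test function with values in [[0, 1]] vanishing on
    [[- K, K]] has expectation at most [P (|Y n| > K)]. *)
Lemma tight_cvg_law Y : (forall n, measurable_fun setT (Y n)) -> tight_seq P Y ->
  (forall f : R -> R, continuous f -> (exists M : R, forall x, `|f x| <= M) ->
    cvgn (fun n => E (fun w => f (Y n w)))) ->
  exists mu : probability R R, forall f, Cb f ->
    (fun n => E (fun w => f (Y n w))) @ \oo --> Rintegral mu setT f.
Proof.
move=> mY tY cY; pose L f := limn (fun n => E (fun w => f (Y n w))).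
have cL f : Cb f -> (fun n => E (fun w => f (Y n w))) @ \oo --> L f.
  by move=> [cf bf]; exact: cY.
have iY f n : Cb f -> int_fun P (fun w => f (Y n w)).
  by move=> Cf; apply/bnd_meas_int/bnd_meas_Cb.
suff tL : tight_functional L.
  have [mu muL] := tf_law tL; exists mu => f Cf.
  by rewrite -muL//; exact: cL.
split.
- move=> f g Cf Cg; apply/cvg_lim => //.
  under eq_fun do (rewrite expectD; [|exact: iY..]).
  by apply: cvgD; exact: cL.
- move=> a f Cf; apply/cvg_lim => //.
  under eq_fun do (rewrite expectZ; [|exact: iY]).
  by apply: cvgMr; exact: cL.
- move=> f g Cf Cg fg; apply: (ler_cvg_to (cL f Cf) (cL g Cg)).
  by apply: nearW => n; apply: le_expect => //; exact: iY.
- apply/cvg_lim => //; under eq_fun do rewrite expect_cst; exact: cvg_cst.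
- move=> e e0; have [K K0 tK] := tY e e0; exists K => // f Cf f01 fK.
  apply: (cvgr_to_le (cL f Cf)); near=> n.
  apply: (@le_trans _ _ (fine (P [set w | K < `|Y n w|]))); last by near: n.
  have mA := measurable_norm_gt K (mY n).
  rewrite -expect_indic//; apply: le_expect; [exact: iY|exact/bnd_meas_int/bnd_meas_indic|].
  move=> w; have [YK|YK] := leP `|Y n w| K; first by rewrite fK.
  by rewrite indicE mem_set//; have /andP[] := f01 (Y n w).
Unshelve. all: by end_near. Qed.

(** A continuous function [g m] squeezed between the indicators of [|y| > m + 1] and [|y| > m]
    transfers the small tail of the limit to [Y n]. *)
Lemma cvg_law_tight Y (mu : probability R R) (c : R) :
  (forall n, measurable_fun setT (Y n)) -> cvg_dist_scaled P Y mu c -> tight_seq P Y.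
Proof.
move=> mY cY e e0.
pose g (m : nat) (y : R) : R := 1 - ramp m%:R 0 `|y|.
have Cg m : Cb (g m).
  split; last by exists 1 => y; have := ramp01 m%:R 0 `|y|; rewrite /g ler_norml; lra.
  move=> y; apply: cvgB; first exact: cvg_cst.
  apply: (@continuous_comp _ _ _ (fun y : R => `|y|) (ramp m%:R 0)); first exact: norm_continuous.
  exact: (Cb_ramp m%:R 0).1.
pose A (m : nat) := [set x : R | m%:R < `|c * x|].
have mc : measurable_fun setT (fun x : R => c * x) by exact: measurable_funM.
have mA m : measurable (A m) by exact: measurable_norm_gt.
have /cvgrPdist_le : fine (mu (A m)) @[m --> \oo] --> (0 : R).
  apply: fineP_cvg0 => //.
  - by move=> m x; rewrite /A/=; apply: le_lt_trans; rewrite ler_nat.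
  - move=> x; exists (Num.bound `|c * x|); rewrite /A/= => /lt_trans.
    by move=> /(_ _ (archi_boundP (normr_ge0 _))); rewrite ltxx.
have e2 : 0 < e / 2 by lra.
move=> /(_ _ e2)[m _ /(_ m (leqnn m))].
rewrite sub0r normrN ger0_norm ?fineP_ge0// => Am.
have gc : Rintegral mu setT (fun x => g m (c * x)) <= e / 2.
  rewrite (le_trans _ Am)// -expect_indic//; apply: le_expect.
  - by apply/bnd_meas_int/bnd_meas_comp => //; [exact: (Cg m).1|exact: (Cg m).2].
  - exact/bnd_meas_int/bnd_meas_indic.
  move=> x; have [xm|xm] := leP `|c * x| m%:R.
    by rewrite /g ramp_eq1// subrr.
  rewrite indicE mem_set// /g -[leRHS]/(1 : R).
  by have := ramp01 m%:R 0 `|c * x|; lra.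
exists (m%:R + 1); first by rewrite ltr_wpDl.
have /cvgrPdist_le/(_ _ e2) := cY _ (Cg m).1 (Cg m).2 => cg.
near=> n.
have mB := measurable_norm_gt (m%:R + 1) (mY n).
apply: (@le_trans _ _ (E (fun w => g m (Y n w)))).
  rewrite -expect_indic//; apply: le_expect.
  - exact/bnd_meas_int/bnd_meas_indic.
  - exact/bnd_meas_int/bnd_meas_Cb.
  move=> w; have [Ym|Ym] := leP `|Y n w| (m%:R + 1).
    rewrite indicE memNset /=; last by rewrite ltNge Ym.
    by rewrite -[leLHS]/(0 : R) /g; have := ramp01 m%:R 0 `|Y n w|; lra.
  rewrite indicE mem_set// /g ramp_eq0 ?subr0// invr1; exact: ltW.
have : `|Rintegral mu setT (fun x => g m (c * x)) - E (fun w => g m (Y n w))| <= e / 2.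
  by near: n.
by rewrite ler_norml; lra.
Unshelve. all: by end_near. Qed.

(** With [phi y = exp (- y)] the moments of [phi] are Laplace transforms at integers. The maximum
    with [exp (- K)] in [psi] keeps the logarithm away from 0, hence continuous everywhere. *)
Lemma laplace_continuity Y : (forall n, measurable_fun setT (Y n)) ->
  (forall n w, 0 <= Y n w) -> tight_seq P Y ->
  (forall s : R, 0 <= s -> cvgn (fun n => E (fun w => expR (- (s * Y n w))))) ->
  exists mu : probability R R, forall f, Cb f ->
    (fun n => E (fun w => f (Y n w))) @ \oo --> Rintegral mu setT f.
Proof.
move=> mY Y0 tY cY; apply: tight_cvg_law => //; apply: cvg_expect_tight => // K K0.
exists (fun y => expR (- y)), (fun z => - ln (Num.max (expR (- K)) z)); split.
- by move=> y; apply: continuous_comp; [exact: opp_continuous|exact: continuous_expR].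
- move=> z; apply: cvgN.
  apply: (@continuous_comp _ _ _ (fun z => Num.max (expR (- K)) z) (@ln R)).
    by apply: (@continuous_max _ _ (cst (expR (- K))) id); [exact: cvg_cst|exact: cvg_id].
  by apply: continuous_ln; rewrite lt_max expR_gt0.
- by move=> n w; rewrite expR_ge0 expR_le1 oppr_le0 Y0.
- move=> n w YK; rewrite max_r ?expRK ?opprK// ler_expR lerN2.
  by move: YK; rewrite ger0_norm.
- move=> j; under eq_fun do under eq_Rintegral do rewrite -expRM_natl mulrN.
  exact: cY.
Qed.

(** Here [phi] is an affine image of [sin (a y)]. Since [a K = 1 / 2] is below [pi / 2], it is
    injective on [[- K, K]]; clipping at [sin (1 / 2) < 1] keeps [asin] inside the open interval
    where it is continuous. *)
Lemma levy_continuity Y : (forall n, measurable_fun setT (Y n)) -> tight_seq P Y ->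
  (forall t : R, cvgn (fun n => E (fun w => cos (t * Y n w)))) ->
  (forall t : R, cvgn (fun n => E (fun w => sin (t * Y n w)))) ->
  exists mu : probability R R, forall f, Cb f ->
    (fun n => E (fun w => f (Y n w))) @ \oo --> Rintegral mu setT f.
Proof.
move=> mY tY cc cs; apply: tight_cvg_law => //; apply: cvg_expect_tight => // K K0.
pose a := (2 * K)^-1.
have a0 : 0 < a by rewrite invr_gt0; lra.
pose phi y : R := (1 + sin (a * y)) / 2.
pose s1 : R := sin (1 / 2).
have pi2 : 1 / 2 < pi / 2 :> R by have := pi_ge2 R; lra.
have hin (x : R) : `|x| <= 1 / 2 -> x \in `[- (pi / 2), pi / 2].
  by rewrite ler_norml in_itv/=; move: pi2; move: (pi / 2) => p; lra.
have hhalf : (1 / 2 : R) \in `[- (pi / 2), pi / 2] by apply: hin; rewrite ger0_norm//; lra.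
have s1lt : s1 < 1.
  rewrite -(sin_pihalf R) ltr_sin// in_itv/= lexx andbT.
  by move: pi2; move: (pi / 2) => p; lra.
have s1gt : 0 < s1.
  rewrite -(sin0 R) ltr_sin//.
  by apply: hin; rewrite normr0; lra.
pose psi z := a^-1 * asin (Num.max (- s1) (Num.min s1 (2 * z - 1))).
exists phi, psi; split.
- move=> y; rewrite /phi; apply: cvgMl; apply: cvgD; first exact: cvg_cst.
  exact: continuous_sinM.
- move=> z; pose u (z : R) : R := 2 * z - 1.
  pose v (z : R) : R := Num.min s1 (u z).
  pose q (z : R) : R := Num.max (- s1) (v z).
  have cu : {for z, continuous u}.
    by apply: cvgB; [apply: cvgMr; exact: cvg_id|exact: cvg_cst].
  have cs1 (y : R) : {for z, continuous (fun=> y)} by exact: cvg_cst.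
  have cv : {for z, continuous v} := continuous_min (cs1 s1) cu.
  have cq : {for z, continuous q} := continuous_max (cs1 (- s1)) cv.
  have q1 : -1 < q z < 1.
    rewrite lt_max gt_max gt_min s1lt/= andbT.
    by apply/andP; split; [apply/orP; left; lra|lra].
  have ca : {for z, continuous (@asin R \o q)}.
    by apply: continuous_comp => //; exact: continuous_asin.
  by apply: cvgMr; exact: ca.
- move=> n w; rewrite /phi; have := sin_geN1 (a * Y n w); have := sin_le1 (a * Y n w).
  by lra.
- move=> n w YK; rewrite /psi /phi.
  have -> : 2 * ((1 + sin (a * Y n w)) / 2) - 1 = sin (a * Y n w) by field.
  have aY : `|a * Y n w| <= 1 / 2.
    rewrite normrM (gtr0_norm a0) /a mulrC ler_pdivrMr; lra.
  have h1 : sin (a * Y n w) <= s1.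
    rewrite leNgt; apply/negP; rewrite /s1 ltr_sin ?hhalf ?(hin _ aY)//.
    by move: aY; rewrite ler_norml; lra.
  have h2 : - s1 <= sin (a * Y n w).
    have hm : (- (1 / 2) : R) \in `[- (pi / 2), pi / 2].
      by apply: hin; rewrite normrN ger0_norm; lra.
    rewrite /s1 -sinN leNgt; apply/negP; rewrite ltr_sin ?hm ?(hin _ aY)//.
    by move: aY; rewrite ler_norml; lra.
  rewrite min_r// max_r// sinK ?hin// mulrA mulVf ?mul1r// gt_eqF//.
have bphi n : bnd_meas (fun w => phi (Y n w)).
  split; last first.
    exists 1 => w; have := sin_geN1 (a * Y n w); have := sin_le1 (a * Y n w).
    by rewrite ler_norml /phi; lra.
  have [ms _] := bnd_meas_sin a (mY n).
  by apply: measurable_funM => //; exact: measurable_funD.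
move=> j.
(* Powers of [phi] are trigonometric polynomials. A free frequency [t] lets product-to-sum formulas
   lower the power [j], at the frequencies [a + t] and [a - t]. *)
suff H : forall t, cvgn (fun n => E (fun w => phi (Y n w) ^+ j * cos (t * Y n w))) /\
    cvgn (fun n => E (fun w => phi (Y n w) ^+ j * sin (t * Y n w))).
  by have [+ _] := H 0; under eq_fun do under eq_Rintegral do rewrite mul0r cos0 mulr1.
elim: j => [|j IH] t.
  split; under eq_fun do under eq_Rintegral do rewrite expr0 mul1r.
    exact: cc.
  exact: cs.
have bc n t' : int_fun P (fun w => phi (Y n w) ^+ j * cos (t' * Y n w)).
  by apply/bnd_meas_int/bnd_measM; [exact: bnd_measX|exact: bnd_meas_cos].
have bs n t' : int_fun P (fun w => phi (Y n w) ^+ j * sin (t' * Y n w)).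
  by apply/bnd_meas_int/bnd_measM; [exact: bnd_measX|exact: bnd_meas_sin].
split.
- rewrite (_ : (fun n => _) = (fun n =>
    2^-1 * E (fun w => phi (Y n w) ^+ j * cos (t * Y n w)) +
    4^-1 * (E (fun w => phi (Y n w) ^+ j * sin ((a + t) * Y n w)) +
            E (fun w => phi (Y n w) ^+ j * sin ((a - t) * Y n w))))).
    apply: is_cvgD; apply: is_cvgMr; first exact: (IH t).1.
    by apply: is_cvgD; exact: (IH _).2.
  apply/funext => n.
  rewrite -expectD// -!expectZ//; last exact: int_funD.
  rewrite -expectD; [|exact: int_funZ|exact/int_funZ/int_funD].
  congr Rintegral; apply/funext => w; rewrite exprS /phi (mulrDl a t) (mulrBl _ a t).
  rewrite (sinD (a * Y n w) (t * Y n w)) (sinB (a * Y n w) (t * Y n w)).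
  by field.
- rewrite (_ : (fun n => _) = (fun n =>
    2^-1 * E (fun w => phi (Y n w) ^+ j * sin (t * Y n w)) +
    4^-1 * (E (fun w => phi (Y n w) ^+ j * cos ((a - t) * Y n w)) -
            E (fun w => phi (Y n w) ^+ j * cos ((a + t) * Y n w))))).
    apply: is_cvgD; apply: is_cvgMr; first exact: (IH t).2.
    by apply: is_cvgB; exact: (IH _).1.
  apply/funext => n.
  rewrite -expectB// -!expectZ//; last exact: int_funB.
  rewrite -expectD; [|exact: int_funZ|exact/int_funZ/int_funB].
  congr Rintegral; apply/funext => w; rewrite exprS /phi (mulrDl a t) (mulrBl _ a t).
  rewrite (cosD (a * Y n w) (t * Y n w)) (cosB (a * Y n w) (t * Y n w)).
  by field.
Qed.

End continuity_theorems.

(** * Random sums: conditioning, tightness and Gaussian comparison *)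

Section random_sums.
Context {R : realType} {d : measure_display} {T : measurableType d}.
Variables (P : probability T R) (X : nat -> T -> R) (sigma2 : nat -> R).
Variables (N : nat -> T -> nat) (dn : nat -> R).

Local Notation E f := (Rintegral P setT f).
Local Notation V k := (\sum_(i < k) sigma2 i).

Hypothesis mX : forall i, measurable_fun setT (X i).
Hypothesis indepX : mutually_independent P X.
Hypothesis iX : forall i, int_fun P (X i).
Hypothesis iX2 : forall i, int_fun P (fun w => X i w ^+ 2).
Hypothesis EX : forall i, E (X i) = 0.
Hypothesis EX2 : forall i, E (fun w => X i w ^+ 2) = sigma2 i.
Hypothesis sigma2_gt0 : forall i, 0 < sigma2 i.
Hypothesis lindeberg : forall tau : R, 0 < tau ->
  (fun k => (V k)^-1 * \sum_(i < k) tail2 P (X i) (tau * Num.sqrt (V k))) @ \oo --> (0 : R).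
Hypothesis mN : forall n k, measurable [set w | N n w = k].
Hypothesis indepN : forall n, indep_of_seq P (N n) X.
Hypothesis Noo : forall m : nat, (fun n => P [set w | (N n w <= m)%N]) @ \oo --> 0%E.
Hypothesis dn_gt0 : forall n, 0 < dn n.

Let Y n w := (\sum_(i < N n w) X i w) / dn n.
Let W n w := V (N n w) / dn n ^+ 2.

Let V0 k : 0 <= V k := V_ge0 sigma2_gt0 k.

Lemma bnd_meas_random n (F : nat -> T -> R) (M : R) :
  (forall k, measurable_fun setT (F k)) -> (forall k w, `|F k w| <= M) ->
  bnd_meas (fun w => F (N n w) w).
Proof. by move=> mF FM; split; [exact: measurable_random_index|exists M]. Qed.

Lemma bnd_meas_index n (h : nat -> R) (M : R) : (forall k, `|h k| <= M) ->
  bnd_meas (fun w => h (N n w)).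
Proof. by move=> hM; apply: (@bnd_meas_random n (fun k _ => h k) M). Qed.

Lemma measurable_random_sum n : measurable_fun setT (Y n).
Proof.
apply: (@measurable_random_index _ _ _ (N n) (fun k w => (\sum_(i < k) X i w) / dn n)) => // k.
by apply: measurable_funM => //; exact: measurable_partial_sum.
Qed.

Lemma measurable_random_var n : measurable_fun setT (W n).
Proof.
exact: (@measurable_random_index _ _ _ (N n) (fun k w => V k / dn n ^+ 2)).
Qed.

Lemma W_ge0 n w : 0 <= W n w.
Proof. by rewrite divr_ge0// exprn_ge0// ltW. Qed.

Lemma measurable_index_le n m : measurable [set w | (N n w <= m)%N].
Proof.
have -> : [set w | (N n w <= m)%N] =
    \bigcup_(k in [set k | (k <= m)%N]) [set w | N n w = k].
  apply/seteqP; split => [w /= Nm|w [k /= km Nk]]; first by exists (N n w).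
  by rewrite /= Nk.
exact: bigcup_measurable.
Qed.

Lemma index_le_near m (e : R) : 0 < e ->
  \forall n \near \oo, fine (P [set w | (N n w <= m)%N]) <= e.
Proof.
move=> e0; have /fine_cvg/cvgrPdist_le/(_ _ e0) := Noo m.
by apply: filterS => n /=; rewrite sub0r normrN ger0_norm// fineP_ge0.
Qed.

(** On each level set of [N n] the weight and the frequency are constants, so both may depend on the
    index. Truncation to large [B_N] and normalisation by [B_N] rely on this. *)
Lemma expect_random_char n (a u : nat -> R) (A : R) : (forall k, `|a k| <= A) ->
  E (fun w => a (N n w) * cos (u (N n w) * \sum_(i < N n w) X i w)) =
    E (fun w => a (N n w) * (char_sum P X (u (N n w)) (N n w)).1) /\
  E (fun w => a (N n w) * sin (u (N n w) * \sum_(i < N n w) X i w)) =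
    E (fun w => a (N n w) * (char_sum P X (u (N n w)) (N n w)).2).
Proof.
move=> aA.
have cs1 := char_sum_le1 mX indepX.
have bI k : bnd_meas (\1_[set w | N n w = k] : T -> R) by exact: bnd_meas_indic.
have aux k := expect_char_sum_aux mX (u k) k (bI k)
  (indep_from0_indic mX indepX (mN n k) (indepN n k)).
have A0 : 0 <= A by rewrite (le_trans _ (aA 0%N)).
have bcos k : bnd_meas (fun w => cos (u k * \sum_(i < k) X i w)).
  exact/bnd_meas_cos/measurable_partial_sum.
have bsin k : bnd_meas (fun w => sin (u k * \sum_(i < k) X i w)).
  exact/bnd_meas_sin/measurable_partial_sum.
have bd (x y : R) : `|x| <= A -> `|y| <= 1 -> `|x * y| <= A.
  by move=> xA y1; rewrite normrM -[leRHS]mulr1 ler_pM.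
split.
- apply: (@expect_random_index _ _ _ P (N n)
    (fun k w => a k * cos (u k * \sum_(i < k) X i w))
    (fun k w => a k * (char_sum P X (u k) k).1) A) => //.
  + by move=> k; apply: measurable_funM => //; exact: (bcos k).1.
  + by move=> k w; apply: bd => //; exact: cos_max.
  + by move=> k w; apply: bd => //; exact: (cs1 _ _).1.
  move=> k; have [_ _ Ec _] := aux k.
  rewrite (_ : (fun w => _ * (a k * cos _)) = (fun w => a k *
    (\1_[set w | N n w = k] w * cos (u k * \sum_(i < k) X i w)))); last first.
    by apply/funext => w; ring.
  rewrite expectZ; last exact/bnd_meas_int/bnd_measM.
  rewrite Ec (_ : (fun w => _ * (a k * _)) = (fun w => a k * (char_sum P X (u k) k).1 *
    \1_[set w | N n w = k] w)); last by apply/funext => w; ring.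
  by rewrite [in RHS]expectZ; [ring|exact: (bnd_meas_int P (bI k))].
- apply: (@expect_random_index _ _ _ P (N n)
    (fun k w => a k * sin (u k * \sum_(i < k) X i w))
    (fun k w => a k * (char_sum P X (u k) k).2) A) => //.
  + by move=> k; apply: measurable_funM => //; exact: (bsin k).1.
  + by move=> k w; apply: bd => //; exact: sin_max.
  + by move=> k w; apply: bd => //; exact: (cs1 _ _).2.
  move=> k; have [_ _ _ Es] := aux k.
  rewrite (_ : (fun w => _ * (a k * sin _)) = (fun w => a k *
    (\1_[set w | N n w = k] w * sin (u k * \sum_(i < k) X i w)))); last first.
    by apply/funext => w; ring.
  rewrite expectZ; last exact/bnd_meas_int/bnd_measM.
  rewrite Es (_ : (fun w => _ * (a k * _)) = (fun w => a k * (char_sum P X (u k) k).2 *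
    \1_[set w | N n w = k] w)); last by apply/funext => w; ring.
  by rewrite [in RHS]expectZ; [ring|exact: (bnd_meas_int P (bI k))].
Qed.

(* For large [k] the normalised sum [2 S_k / B_k] is nearly Gaussian, hence is
   not concentrated near [0]; so [B_N] cannot be much larger than [|S_N|]. *)
Lemma tight_var_of_tight_sum : tight_seq P Y -> tight_seq P W.
Proof.
move=> tY e e0.
have e8 : 0 < e / 8 by lra.
have [K K0 tK] := tY _ e8.
(* At [u B_k = 2] the Gaussian value is [exp (- 2) <= 1 / 3]; the error [1 / 24] leaves
   [1 - 1 / 3 - 1 / 24 = 5 / 8]. *)
have [k0 _ L] := char_sum_lindeberg mX indepX iX iX2 EX EX2 sigma2_gt0 lindeberg
  (K := 2) (e := 1 / 24) ltac:(lra) ltac:(lra).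
(* If [|Y n| <= K] and [W n > 16 K^2], then [(2 S_N / B_N)^2 <= 1 / 4], so that [1 - cos] is at most
   [1 / 8]. *)
exists (16 * K ^+ 2); first by rewrite mulr_gt0// exprn_gt0.
have e2 : 0 < e / 2 by lra.
near=> n.
have d0 := dn_gt0 n.
pose a k : R := ((k0 < k)%N && (16 * K ^+ 2 * dn n ^+ 2 < V k))%:R.
have a01 k : a k = 0 \/ a k = 1 by rewrite /a; case: (_ && _); [right|left].
have a1 k : `|a k| <= 1 by case: (a01 k) => ->; rewrite ?normr0 ?normr1.
pose u k := 2 / Num.sqrt (V k).
have [Hc _] := expect_random_char n u a1.
have mS := measurable_partial_sum mX.
have cs1 := char_sum_le1 mX indepX.
have ba : bnd_meas (fun w => a (N n w)) := bnd_meas_index n a1.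
have bcos k : bnd_meas (fun w => cos (u k * \sum_(i < k) X i w)) by exact/bnd_meas_cos/mS.
have bac : bnd_meas (fun w => a (N n w) * cos (u (N n w) * \sum_(i < N n w) X i w)).
  apply: (@bnd_meas_random n (fun k w => a k * cos (u k * \sum_(i < k) X i w)) 1).
    by move=> k; apply: measurable_funM => //; exact: (bcos k).1.
  by move=> k w; rewrite normrM mulr_ile1// cos_max.
have bach : bnd_meas (fun w => a (N n w) * (char_sum P X (u (N n w)) (N n w)).1).
  apply: (@bnd_meas_index n (fun k => a k * (char_sum P X (u k) k).1) 1) => k.
  by rewrite normrM mulr_ile1//; exact: (cs1 _ _).1.
pose A := [set w | K < `|Y n w|].
have mA : measurable A by exact/measurable_norm_gt/measurable_random_sum.
have PA : fine (P A) <= e / 8 by rewrite /A; near: n.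
have bA := bnd_meas_indic mA : bnd_meas (\1_A : T -> R).
have iA := bnd_meas_int P bA; have ia := bnd_meas_int P ba.
have iac := bnd_meas_int P bac; have iach := bnd_meas_int P bach.
have exp2 : expR (- 2) <= 3^-1 :> R.
  have h := expR_ge1Dx (2 : R).
  by rewrite expRN lef_pV2 ?posrE ?expR_gt0//; lra.
have low : 5 / 8 * E (fun w => a (N n w)) <=
    E (fun w => a (N n w)) - E (fun w => a (N n w) * cos (u (N n w) * \sum_(i < N n w) X i w)).
  rewrite Hc -expectB// -expectZ//; apply: le_expect.
  - exact: int_funZ.
  - exact: int_funB.
  move=> w; rewrite /a; case: (boolP (_ && _)) => [/andP[kN _]|_] /=; last by rewrite mulr0 mul0r subr0.
  rewrite mulr1 mul1r -[1%:R]/(1 : R).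
  have VN : 0 < V (N n w) by apply: V_gt0 => //; exact: leq_ltn_trans kN.
  have sq : 0 < Num.sqrt (V (N n w)) by rewrite sqrtr_gt0.
  have [] := L (N n w) (ltnW kN) (u (N n w)).
    by rewrite /u normrM normfV !gtr0_norm// divfK ?gt_eqF.
  have -> : u (N n w) ^+ 2 * V (N n w) / 2 = 2.
    rewrite /u exprMn exprVn sqr_sqrtr//.
    by field; rewrite gt_eqF.
  by rewrite ler_norml => /andP[_ hc] _; lra.
have upp : E (fun w => a (N n w)) -
    E (fun w => a (N n w) * cos (u (N n w) * \sum_(i < N n w) X i w)) <=
    8^-1 * E (fun w => a (N n w)) + 2 * E \1_A.
  rewrite -expectB// -!expectZ// -expectD; [|exact: int_funZ..].
  apply: le_expect; [exact: int_funB|by apply: int_funD; exact: int_funZ|].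
  move=> w; rewrite /a; case: (boolP (_ && _)) => [/andP[kN VN]|_] /=; last first.
    by rewrite mul0r subr0 mulr0 add0r mulr_ge0// indicE.
  rewrite mulr1 mul1r -[1%:R]/(1 : R).
  set x := u (N n w) * _.
  have [YK|YK] := leP `|Y n w| K; last first.
    rewrite indicE mem_set// -[1%:R]/(1 : R).
    by have := cos_geN1 x; lra.
  rewrite indicE memNset; last by rewrite /A/= ltNge YK.
  rewrite -[0%:R]/(0 : R) mulr0 addr0.
  apply: (le_trans (cos_ge_quadratic x)).
  have VN0 : 0 < V (N n w).
    by apply: lt_trans VN; rewrite !mulr_gt0// exprn_gt0.
  have x2 : x ^+ 2 = 4 * (Y n w ^+ 2 * dn n ^+ 2) / V (N n w).
    rewrite /x /u /Y !exprMn !exprVn sqr_sqrtr//.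
    by field; rewrite !gt_eqF.
  have : x ^+ 2 <= 4^-1.
    rewrite x2 ler_pdivrMr// .
    have : Y n w ^+ 2 <= K ^+ 2.
      by rewrite -(real_normK (num_real (Y n w))) ler_sqr ?nnegrE// ltW.
    have := exprn_gt0 2 d0; move: VN; move: (V _) (Y n w ^+ 2) (K ^+ 2) (dn n ^+ 2).
    by move=> v y k dd; nra.
  by lra.
(* The two estimates give [5 / 8 p <= p / 8 + 2 P (A)] for [p = E a], that is [p <= 4 P (A)]. *)
have Ea : E (fun w => a (N n w)) <= e / 2.
  rewrite expect_indic// in upp; lra.
pose B := [set w | (N n w <= k0)%N].
have mB : measurable B := measurable_index_le n k0.
have PB : fine (P B) <= e / 2 by rewrite /B; near: n; exact: index_le_near.
have mD : measurable [set w | 16 * K ^+ 2 < `|W n w|].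
  exact/measurable_norm_gt/measurable_random_var.
rewrite -expect_indic//.
apply: (@le_trans _ _ (E (fun w => a (N n w) + \1_B w))); last first.
  rewrite expectD//; last exact: (bnd_meas_int P (bnd_meas_indic mB)).
  by rewrite expect_indic//; lra.
apply: le_expect.
- exact: (bnd_meas_int P (bnd_meas_indic mD)).
- by apply: int_funD => //; exact: (bnd_meas_int P (bnd_meas_indic mB)).
move=> w; rewrite [leLHS]indicE.
have aN0 : 0 <= a (N n w) by case: (a01 (N n w)) => ->.
have B0 : 0 <= \1_B w :> R by rewrite indicE.
case: (boolP (w \in _)) => [/set_mem /=|_]; last by rewrite addr_ge0.
rewrite ger0_norm ?W_ge0// /W ltr_pdivlMr ?exprn_gt0// => VN.
have [Nk|Nk] := leqP (N n w) k0; first by rewrite indicE mem_set// lerDr.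
by rewrite /a Nk VN /= lerDl.
Unshelve. all: by end_near. Qed.

(* Truncated Chebyshev inequality: [1 - cos (S_k / (m d))] dominates
   [S_k^2 / (4 m^2 d^2)] on [|S_k| <= m d], and [m] is sent to infinity. *)
Lemma tight_sum_of_tight_var : tight_seq P W -> tight_seq P Y.
Proof.
move=> tW e e0.
have e4 : 0 < e / 4 by lra.
have [K' K'0 tK'] := tW _ e4.
(* The Chebyshev term will be [12 K' / K^2]; it is at most [e / 4] because [K >= 48 K' / e] and
   [K^2 >= K]. *)
pose K := 48 * K' / e + 1.
have K1 : 1 <= K by rewrite lerDr divr_ge0 ?mulr_ge0 ?(ltW e0) ?(ltW K'0).
have K0 : 0 < K by lra.
have KK' : 12 * K' <= e / 4 * K ^+ 2.
  have h : 48 * K' <= e * K by rewrite /K mulrDr mulrCA divff ?gt_eqF// mulr1; lra.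
  have : K <= K ^+ 2 by rewrite expr2 ler_peMl// ltW.
  by move: (K ^+ 2) => q; nra.
exists K => //; near=> n.
have d0 := dn_gt0 n.
have mY := measurable_random_sum n.
(* Here [n] is fixed. The cutoff [m] may depend on it, because [M = m + 1] cancels between the
   factor [q] and the bound on [E D]. *)
pose A m := [set w | m.+1%:R < `|Y n w|].
have mA m : measurable (A m) by exact: measurable_norm_gt.
have /cvgrPdist_le : fine (P (A m)) @[m --> \oo] --> (0 : R).
  apply: fineP_cvg0 => //.
  - by move=> m w; rewrite /A/=; apply: le_lt_trans; rewrite ler_nat.
  - move=> w; exists (Num.bound `|Y n w|); rewrite /A/= => /lt_trans.
    move=> /(_ _ (archi_boundP (normr_ge0 _))).
    by rewrite ltr_nat ltnNge leqnSn.
move=> /(_ _ e4)[m _ /(_ m (leqnn m))].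
rewrite sub0r normrN ger0_norm ?fineP_ge0// => PA.
pose M : R := m.+1%:R.
have M0 : 0 < M by [].
pose a k : R := (V k / dn n ^+ 2 <= K')%R%:R.
have a01 k : a k = 0 \/ a k = 1 by rewrite /a; case: (_ <= _); [right|left].
have a1 k : `|a k| <= 1 by case: (a01 k) => ->; rewrite ?normr0 ?normr1.
pose u (k : nat) := (M * dn n)^-1.
have [Hc _] := expect_random_char n u a1.
have mS := measurable_partial_sum mX.
have cs1 := char_sum_le1 mX indepX.
have ba : bnd_meas (fun w => a (N n w)) := bnd_meas_index n a1.
have bcos k : bnd_meas (fun w => cos (u k * \sum_(i < k) X i w)) by exact/bnd_meas_cos/mS.
have bac : bnd_meas (fun w => a (N n w) * cos (u (N n w) * \sum_(i < N n w) X i w)).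
  apply: (@bnd_meas_random n (fun k w => a k * cos (u k * \sum_(i < k) X i w)) 1).
    by move=> k; apply: measurable_funM => //; exact: (bcos k).1.
  by move=> k w; rewrite normrM mulr_ile1// cos_max.
have bach : bnd_meas (fun w => a (N n w) * (char_sum P X (u (N n w)) (N n w)).1).
  apply: (@bnd_meas_index n (fun k => a k * (char_sum P X (u k) k).1) 1) => k.
  by rewrite normrM mulr_ile1//; exact: (cs1 _ _).1.
pose D w := a (N n w) - a (N n w) * cos (u (N n w) * \sum_(i < N n w) X i w).
have ia := bnd_meas_int P ba; have iac := bnd_meas_int P bac.
have iach := bnd_meas_int P bach.
have iD : int_fun P D by exact: int_funB.
have ED : E D <= 3 * K' / M ^+ 2.
  rewrite /D expectB// Hc -expectB// -[leRHS](expect_cst P).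
  apply: le_expect; [exact: int_funB|exact: int_fun_cst|move=> w].
  have q0 : 0 <= 3 * K' / M ^+ 2.
    by rewrite divr_ge0 ?exprn_ge0 ?mulr_ge0// ltW.
  rewrite /a; case: (boolP (V (N n w) / dn n ^+ 2 <= K')) => [WK|_] /=; last by rewrite mul0r subr0.
  rewrite mul1r -[1%:R]/(1 : R).
  apply: (le_trans (ler_norm _)).
  apply: (le_trans (char_sum_quadratic mX indepX iX iX2 EX EX2 sigma2_gt0 _ _)).
  have -> : 3 * (u (N n w) ^+ 2 * V (N n w)) = 3 * (V (N n w) / dn n ^+ 2) / M ^+ 2.
    by rewrite /u; field; rewrite !gt_eqF.
  by rewrite ler_pM2r ?invr_gt0 ?exprn_gt0// ler_pM2l.
pose B := [set w | K' < `|W n w|].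
have mB : measurable B by exact/measurable_norm_gt/measurable_random_var.
have PB : fine (P B) <= e / 4 by rewrite /B; near: n.
have iB := bnd_meas_int P (bnd_meas_indic mB).
have iA := bnd_meas_int P (bnd_meas_indic (mA m)).
have mC : measurable [set w | K < `|Y n w|] by exact: measurable_norm_gt.
pose q := 4 * M ^+ 2 / K ^+ 2.
have q0 : 0 < q by rewrite divr_gt0 ?mulr_gt0 ?exprn_gt0.
have D0 w : 0 <= D w.
  rewrite /D; have := cos_le1 (u (N n w) * \sum_(i < N n w) X i w).
  by case: (a01 (N n w)) => ->; lra.
rewrite -expect_indic//.
apply: (@le_trans _ _ (E (fun w => \1_B w + (q * D w + \1_(A m) w)))); last first.
  rewrite expectD//; last by apply: int_funD => //; exact: int_funZ.
  rewrite expectD//; last exact: int_funZ.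
  rewrite expectZ// !expect_indic//.
  have : q * E D <= e / 4.
    apply: (@le_trans _ _ (q * (3 * K' / M ^+ 2))); first by rewrite ler_pM2l.
    have -> : q * (3 * K' / M ^+ 2) = 12 * K' / K ^+ 2.
      by rewrite /q; field; rewrite !gt_eqF.
    by rewrite ler_pdivrMr// exprn_gt0.
  by lra.
apply: le_expect.
- exact: (bnd_meas_int P (bnd_meas_indic mC)).
- by apply: int_funD => //; apply: int_funD => //; exact: int_funZ.
move=> w; rewrite [leLHS]indicE.
have B0 : 0 <= \1_B w :> R by rewrite indicE.
have A0 : 0 <= \1_(A m) w :> R by rewrite indicE.
have qD0 : 0 <= q * D w by rewrite mulr_ge0// ltW.
case: (boolP (w \in _)) => [/set_mem /= KY|_]; last by rewrite !addr_ge0.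
rewrite -[1%:R]/(1 : R).
have [WK|WK] := leP `|W n w| K'; last first.
  by have -> : \1_B w = 1 :> R; [rewrite indicE mem_set|lra].
have [YM|YM] := leP `|Y n w| M; last first.
  by have -> : \1_(A m) w = 1 :> R; [rewrite indicE mem_set|lra].
have aN : a (N n w) = 1.
  by rewrite /a; move: WK; rewrite ger0_norm ?W_ge0// /W => ->.
have x0 : u (N n w) * \sum_(i < N n w) X i w = Y n w / M.
  by rewrite /u /Y; field; rewrite !gt_eqF.
have : 1 <= q * D w.
  rewrite /D aN mul1r x0.
  have yM : `|Y n w / M| <= 1 by rewrite normrM normfV (gtr0_norm M0) ler_pdivrMr// mul1r.
  have h := cos_le_quadratic yM.
  have h2 : K ^+ 2 / M ^+ 2 / 4 <= 1 - cos (Y n w / M).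
    apply: (le_trans _ h); rewrite ler_pM2r// expr_div_n ler_pM2r ?invr_gt0 ?exprn_gt0//.
    by rewrite -(real_normK (num_real (Y n w))) ler_sqr ?nnegrE// ltW.
  apply: (@le_trans _ _ (q * (K ^+ 2 / M ^+ 2 / 4))); last by rewrite ler_pM2l.
  rewrite le_eqVlt; apply/orP; left; apply/eqP.
  by rewrite /q; field; rewrite !gt_eqF.
by lra.
Unshelve. all: by end_near. Qed.

(** At frequency [t / d_n] the Gaussian exponent is [t^2 W n / 2], and [|t| sqrt (W n)] stays in the
    uniform range as long as [W n <= K]. *)
Lemma trig_random_sum_near (t e : R) : tight_seq P W -> 0 < e ->
  \forall n \near \oo,
    `|E (fun w => cos (t * Y n w)) - E (fun w => expR (- (t ^+ 2 * W n w / 2)))| <= e /\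
    `|E (fun w => sin (t * Y n w))| <= e.
Proof.
move=> tW e0.
have e8 : 0 < e / 8 by lra.
have e2 : 0 < e / 2 by lra.
have [K K0 tK] := tW _ e8.
(* The [+ 1] keeps the radius positive when [t = 0]. *)
have K10 : 0 < `|t| * Num.sqrt K + 1 by rewrite ltr_wpDl// mulr_ge0// sqrtr_ge0.
have [k0 _ L] := char_sum_lindeberg mX indepX iX iX2 EX EX2 sigma2_gt0 lindeberg K10 e2.
near=> n.
have d0 := dn_gt0 n.
pose u (k : nat) := t / dn n.
have [Hc Hs] := @expect_random_char n (fun=> 1) u 1 (fun=> ltac:(by rewrite normr1)).
have cs1 := char_sum_le1 mX indepX.
have tY w : t * Y n w = t / dn n * \sum_(i < N n w) X i w.
  by rewrite /Y; ring.
have Hc' : E (fun w => cos (t * Y n w)) = E (fun w => (char_sum P X (u (N n w)) (N n w)).1).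
  under eq_fun do rewrite tY.
  move: Hc; under eq_fun do rewrite mul1r; move=> ->.
  by under eq_fun do rewrite mul1r.
have Hs' : E (fun w => sin (t * Y n w)) = E (fun w => (char_sum P X (u (N n w)) (N n w)).2).
  under eq_fun do rewrite tY.
  move: Hs; under eq_fun do rewrite mul1r; move=> ->.
  by under eq_fun do rewrite mul1r.
pose A := [set w | K < `|W n w|].
have mA : measurable A by exact/measurable_norm_gt/measurable_random_var.
have PA : fine (P A) <= e / 8 by rewrite /A; near: n.
pose B := [set w | (N n w <= k0)%N].
have mB : measurable B := measurable_index_le n k0.
have PB : fine (P B) <= e / 8 by rewrite /B; near: n; exact: index_le_near.
have iA := bnd_meas_int P (bnd_meas_indic mA).
have iB := bnd_meas_int P (bnd_meas_indic mB).
(* On the exceptional events [W n > K] and [N n <= k0] the trivial bound 2 is used. Each has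
   probability at most [e / 8], so [E G <= e]. *)
pose G w : R := e / 2 + (2 * \1_A w + 2 * \1_B w).
have iAB : int_fun P (fun w => 2 * \1_A w + 2 * \1_B w) by apply: int_funD; exact: int_funZ.
have iG : int_fun P G by apply: int_funD => //; exact: int_fun_cst.
have EG : E G <= e.
  rewrite /G expectD//; last exact: int_fun_cst.
  rewrite expect_cst expectD; [|exact: int_funZ..].
  by rewrite (expectZ 2 iA) (expectZ 2 iB) !expect_indic//; lra.
have bexp : bnd_meas (fun w => expR (- (t ^+ 2 * W n w / 2))).
  apply: (@bnd_meas_index n (fun k => expR (- (t ^+ 2 * (V k / dn n ^+ 2) / 2))) 1) => k.
  rewrite ger0_norm ?expR_ge0// expR_le1 oppr_le0.
  by rewrite divr_ge0// mulr_ge0 ?sqr_ge0// divr_ge0// exprn_ge0// ltW.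
have exp1 w : 0 <= expR (- (t ^+ 2 * W n w / 2)) <= 1.
  rewrite expR_ge0/= expR_le1 oppr_le0 divr_ge0// mulr_ge0 ?sqr_ge0//.
  exact: W_ge0.
have bc1 : bnd_meas (fun w => (char_sum P X (u (N n w)) (N n w)).1).
  exact: (@bnd_meas_index n (fun k => (char_sum P X (u k) k).1) 1 (fun k => (cs1 _ _).1)).
have bc2 : bnd_meas (fun w => (char_sum P X (u (N n w)) (N n w)).2).
  exact: (@bnd_meas_index n (fun k => (char_sum P X (u k) k).2) 1 (fun k => (cs1 _ _).2)).
have pt w : `|(char_sum P X (u (N n w)) (N n w)).1 - expR (- (t ^+ 2 * W n w / 2))| <= G w
    /\ `|(char_sum P X (u (N n w)) (N n w)).2| <= G w.
  have A0 : 0 <= \1_A w :> R by rewrite indicE.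
  have B0 : 0 <= \1_B w :> R by rewrite indicE.
  have [c1 c2] := cs1 (u (N n w)) (N n w).
  have triv : 1 <= \1_A w + \1_B w :> R ->
    `|(char_sum P X (u (N n w)) (N n w)).1 - expR (- (t ^+ 2 * W n w / 2))| <= G w
    /\ `|(char_sum P X (u (N n w)) (N n w)).2| <= G w.
    move=> AB; have G2 : 2 <= G w by rewrite /G; lra.
    split; apply: (le_trans _ G2); last by lra.
    by move: c1; rewrite !ler_norml; have := exp1 w; lra.
  have [WK|WK] := leP `|W n w| K; last first.
    by apply: triv; have -> : \1_A w = 1 :> R; [rewrite indicE mem_set|lra].
  have [Nk|Nk] := leqP (N n w) k0.
    by apply: triv; have -> : \1_B w = 1 :> R; [rewrite indicE mem_set|lra].
  have [] := L (N n w) (ltnW Nk) (u (N n w)).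
    rewrite ger0_norm ?W_ge0// in WK.
    apply: (@le_trans _ _ (`|t| * Num.sqrt K)); last by rewrite lerDl.
    have -> : `|u (N n w)| * Num.sqrt (V (N n w)) = `|t| * Num.sqrt (W n w).
      rewrite /u /W normrM normfV (gtr0_norm d0) sqrtrM// sqrtrV ?exprn_ge0 ?(ltW d0)//.
      by rewrite sqrtr_sqr (gtr0_norm d0); ring.
    by rewrite ler_wpM2l// ler_wsqrtr.
  have -> : u (N n w) ^+ 2 * V (N n w) / 2 = t ^+ 2 * W n w / 2.
    by rewrite /u /W; field; rewrite gt_eqF.
  by move=> h1 h2; rewrite /G; split; [move: h1|move: h2]; lra.
rewrite Hc' Hs'; split; apply: (le_trans _ EG).
- by apply: expectB_norm_le => //; [exact: bnd_meas_int..|move=> w; have [] := pt w].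
- by apply: norm_expect_le => //; [exact: bnd_meas_int|move=> w; have [] := pt w].
Unshelve. all: by end_near. Qed.

End random_sums.

(** * Limits of nonnegative variables and transforms on the half-line *)

Section law_limits.
Context {R : realType}.

Lemma cvg_near_dist (a b : nat -> R) (l : R) :
  (forall e : R, 0 < e -> \forall n \near \oo, `|a n - b n| <= e) ->
  a @ \oo --> l -> b @ \oo --> l.
Proof.
move=> ab al; apply/cvgrPdist_le => e e0.
have e2 : 0 < e / 2 by lra.
near=> n.
have h1 : `|a n - b n| <= e / 2 by near: n; exact: ab.
have h2 : `|l - a n| <= e / 2 by near: n; move/cvgrPdist_le : al; apply.
have -> : l - b n = (l - a n) + (a n - b n) by ring.
by rewrite (le_trans (ler_normD _ _))//; lra.
Unshelve. all: by end_near. Qed.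

Lemma eq_cvgn (u v : nat -> R) (l l' : R) : u =1 v -> l = l' ->
  u @ \oo --> l -> v @ \oo --> l'.
Proof. by move=> /funext -> ->. Qed.

(** Weak convergence only tests bounded functions, and [exp (- s x)] is unbounded on the negative
    axis; for a law on the half-line, [x] can be replaced by its positive part. *)
Lemma Rintegral_nonneg_law (mu : probability R R) (f : R -> R) :
  mu `[0, +oo[%classic = 1%E -> measurable_fun setT f ->
  Rintegral mu setT f = Rintegral mu setT (fun x => f (Num.max 0 x)).
Proof.
move=> mu1 mf; congr fine.
have mu0 : mu (~` `[0, +oo[%classic) = 0%E by rewrite probability_setC// mu1 subee.
have mmax : measurable_fun setT (fun x : R => Num.max 0 x).
  by apply: measurable_maxr => //; exact: measurable_id.
apply: ae_eq_integral => //.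
- exact/measurable_EFinP.
- by apply/measurable_EFinP; exact: (measurableT_comp mf mmax).
exists (~` `[0, +oo[%classic); split.
- exact: measurableC.
- exact: mu0.
- move=> x /= H x0; apply: H => _.
  by move: x0; rewrite in_itv/= andbT => x0; rewrite max_r.
Qed.

(** The ramp of index [k] at [- 1 / (k + 1)] vanishes on the half-line, so [mu] gives no mass to
    []-oo, - 1 / (k + 1)]]. The remaining intervals []- 1 / (k + 1), 0[] shrink to the empty set. *)
Lemma nonneg_law_of_cvg (d : measure_display) (T : measurableType d)
    (P : probability T R) (Z : nat -> T -> R) (mu : probability R R) :
  (forall n w, 0 <= Z n w) ->
  (forall f, Cb f -> (fun n => Rintegral P setT (fun w => f (Z n w))) @ \oo -->
    Rintegral mu setT f) ->
  mu `[0, +oo[%classic = 1%E.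
Proof.
move=> Z0 cZ.
have neg k : fine (mu `]-oo, (- k.+1%:R^-1)]%classic) = 0.
  have r0 : Rintegral mu setT (ramp (- k.+1%:R^-1) k) = 0.
    apply: (cvg_unique _ (cZ _ (Cb_ramp _ _))) => //.
    rewrite (_ : (fun n => _) = (fun=> 0)); first exact: cvg_cst.
    apply/funext => n; rewrite -[RHS](expect_cst P); congr Rintegral.
    by apply/funext => w; rewrite ramp_eq0// addNr.
  apply/eqP; rewrite eq_le fineP_ge0 andbT -[leRHS]r0 -expect_indic//.
  apply: le_expect.
  - exact: (bnd_meas_int mu (bnd_meas_indic _)).
  - have [cr br] := Cb_ramp (- k.+1%:R^-1 : R) k.
    by apply: bnd_meas_int; split => //; exact: continuous_measurable_fun.
  move=> x; rewrite indicE; case: (boolP (x \in _)) => [/set_mem|_] /=.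
    by rewrite in_itv/= => xk; rewrite ramp_eq1.
  by have /andP[] := ramp01 (- k.+1%:R^-1 : R) k x.
pose A k := `](- k.+1%:R^-1 : R), 0[%classic.
have A0 : fine (mu (A k)) @[k --> \oo] --> (0 : R).
  apply: fineP_cvg0.
  - by move=> k; exact: measurable_itv.
  - move=> k x; rewrite /A /= !in_itv/= => /andP[h ->]; rewrite andbT.
    by apply: le_lt_trans h; rewrite lerN2 lef_pV2 ?posrE// ler_nat.
  - move=> x; have [x0|x0] := leP 0 x.
      by exists 0%N; rewrite /A/= in_itv/= [x < 0]ltNge x0 andbF.
    have nx : 0 < - x by rewrite oppr_gt0.
    have [k _ Hk] := near_infty_natSinv_lt (PosNum nx).
    exists k; rewrite /A/= in_itv/= => /andP[h _].
    have := Hk k (leqnn k) => /= h2.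
    by move: h h2; move: (k.+1%:R^-1) => z; lra.
have mneg : fine (mu `]-oo, 0[%classic) = 0.
  apply/eqP; rewrite eq_le fineP_ge0 andbT.
  apply: (cvgr_to_ge A0); apply: nearW => k.
  have -> : `]-oo, 0[%classic = `]-oo, (- k.+1%:R^-1)]%classic `|` A k :> set R.
    apply/seteqP; split => x /=; rewrite /A /= !in_itv/=.
      by move=> x0; have [h|h] := leP x (- k.+1%:R^-1); [left|right].
    case=> [h|/andP[]//]; apply: (le_lt_trans h).
    by rewrite oppr_lt0 invr_gt0.
  apply: (le_trans (fineP_setU_le mu (measurable_itv _) (measurable_itv _))).
  by rewrite neg add0r.
have -> : `[0, +oo[%classic = ~` `]-oo, 0[%classic :> set R.
  by rewrite setCitvl.
rewrite probability_setC// -[X in (1 - X)%E]fineK ?fin_num_measure// mneg.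
by rewrite sube0.
Qed.

End law_limits.

(** * Transfer between the Fourier and Laplace sides of the equivalence *)

Unset Implicit Arguments.

Theorem theorem7 (R : realType) (d : measure_display) (T : measurableType d)
  (P : probability T R) (alpha nu : R)
  (X : nat -> T -> R) (sigma2 : nat -> R) (N : nat -> T -> nat) (dn : nat -> R) :
  0 < alpha <= 2 -> 0 < nu ->
  (forall i, measurable_fun setT (X i)) ->
  mutually_independent P X ->
  (forall i, X i \in Lfun P 2%:E) ->
  (forall i, ('E_P[X i] = 0)%E) ->
  (forall i, variance P (X i) = (sigma2 i)%:E) ->
  (forall i, 0 < sigma2 i) ->
  (let B := fun n => Num.sqrt (\sum_(i < n) sigma2 i) in
   forall tau : R, 0 < tau ->
     (fun n => (B n ^+ 2)^-1 * \sum_(i < n)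
        fine (\int[P]_(w in [set w | tau * B n <= `|X i w|]) ((X i w) ^+ 2)%:E))
       @ \oo --> 0) ->
  (forall n k, measurable [set w | N n w = k]) ->
  (forall n, indep_of_seq P (N n) X) ->
  (forall m : nat, (fun n => P [set w | (N n w <= m)%N]) @ \oo --> 0%E) ->
  (forall n, 0 < dn n) ->
  dn @ \oo --> +oo ->
  cvg_dist_L P (fun n w => (\sum_(i < N n w) X i w) / dn n) alpha nu <->
  cvg_dist_cM P (fun n w => (\sum_(i < N n w) sigma2 i) / dn n ^+ 2) 2 (alpha / 2) nu.
Proof.
move=> /andP[alpha0 _] _ mX indepX X2 EX VX s0 lind mN indepN Noo d0 _.
have mom i := centered_Lfun2 (X2 i) (EX i) (VX i).
have iX i : int_fun P (X i) by have [] := mom i.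
have iX2 i : int_fun P (fun w => X i w ^+ 2) by have [] := mom i.
have EX' i : Rintegral P setT (X i) = 0 by have [] := mom i.
have EX2 i : Rintegral P setT (fun w => X i w ^+ 2) = sigma2 i by have [] := mom i.
pose V k := \sum_(i < k) sigma2 i.
have V0 k : 0 <= V k := V_ge0 s0 k.
have lind' (tau : R) : 0 < tau -> (fun k => (V k)^-1 *
    \sum_(i < k) tail2 P (X i) (tau * Num.sqrt (V k))) @ \oo --> (0 : R).
  move=> /lind; apply: eq_cvgn => // k.
  rewrite sqr_sqrtr ?V0//; congr (_ * _); apply: eq_bigr => i _.
  by rewrite tail2E.
pose Y n w := (\sum_(i < N n w) X i w) / dn n.
pose W n w := (\sum_(i < N n w) sigma2 i) / dn n ^+ 2.
have mY n : measurable_fun setT (Y n) := measurable_random_sum dn mX mN n.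
have mW n : measurable_fun setT (W n) := measurable_random_var sigma2 dn mN n.
have W0 n w : 0 <= W n w := W_ge0 N s0 d0 n w.
have Wmax n w : Num.max 0 (W n w) = W n w by rewrite max_r.
have trig tW t e := @trig_random_sum_near R d T P X sigma2 N dn mX indepX iX iX2 EX' EX2
  s0 lind' mN indepN Noo d0 t e tW.
have Cmax (c : R) : 0 <= c -> Cb (fun x : R => expR (- (c * Num.max 0 x))).
  move=> c0; split.
    have cm (x : R) : {for x, continuous (fun y : R => Num.max 0 y)}.
      have c1 : {for x, continuous (fun=> 0 : R)} by exact: cvg_cst.
      have c2 : {for x, continuous (fun y : R => y)} by exact: cvg_id.
      exact: (continuous_max c1 c2).
    move=> x; apply: (@continuous_comp _ _ _ (fun y : R => - (c * Num.max 0 y)) (@expR R)).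
      by apply: cvgN; apply: cvgMr; exact: cm.
    exact: continuous_expR.
  exists 1 => x; rewrite ger0_norm ?expR_ge0// expR_le1 oppr_le0 mulr_ge0//.
  by rewrite le_max lexx.
have mexp (c : R) : measurable_fun setT (fun x : R => expR (- (c * x))).
  apply: continuous_measurable_fun => x.
  apply: (@continuous_comp _ _ _ (fun y : R => - (c * y)) (@expR R)).
    by apply: cvgN; apply: cvgMr; exact: cvg_id.
  exact: continuous_expR.
have ctrig (t : R) : Cb (fun x : R => cos (t * x)) /\ Cb (fun x : R => sin (t * x)).
  split; split.
  - exact: continuous_cosM.
  - by exists 1 => x; exact: cos_max.
  - exact: continuous_sinM.
  - by exists 1 => x; exact: sin_max.
split => [[mu [lawL cY]]|[mu [[mu1 lawM] cW]]].
- have tW : tight_seq P W.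
    apply: (tight_var_of_tight_sum mX indepX iX iX2 EX' EX2 s0 lind' mN indepN Noo d0).
    exact: (cvg_law_tight mY cY).
  (* The law required by the conclusion is that of the limit of [W n / 2]; the scale 2 reappears as
     the test function [f (2 * x)]. *)
  pose Z n w := W n w / 2.
  have Z0 n w : 0 <= Z n w by rewrite divr_ge0.
  have mZ n : measurable_fun setT (Z n) by exact: measurable_funM.
  have tZ : tight_seq P Z.
    move=> e e0; have [K K0 tK] := tW e e0; exists K => //.
    apply: filterS tK => n; apply: le_trans; apply: le_fineP.
    - exact: measurable_norm_gt.
    - exact: measurable_norm_gt.
    move=> w /=; rewrite !ger0_norm// => /lt_le_trans; apply.
    by rewrite /Z ler_pdivrMr// ler_peMr// ler1n.
  have lap s : 0 <= s -> (fun n => Rintegral P setT (fun w => expR (- (s * Z n w)))) @ \oo -->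
      (1 + s `^ (alpha / 2)) `^ (- nu).
    (* With [t^2 = s] the Gaussian exponent [t^2 W n / 2] becomes [s Z n], and [|t|^alpha] becomes
       [s^(alpha / 2)]. *)
    move=> sge0; pose t := Num.sqrt s.
    have t2 : t ^+ 2 = s by rewrite sqr_sqrtr.
    have -> : s `^ (alpha / 2) = `|t| `^ alpha.
      rewrite ger0_norm ?sqrtr_ge0// /t -powR12_sqrt// -powRrM; congr (_ `^ _).
      by rewrite mulrC.
    have [<- _] := lawL t.
    apply: (@cvg_near_dist R (fun n => Rintegral P setT (fun w => cos (t * Y n w)))).
      move=> e e0; have := trig tW t e e0; apply: filterS => n [+ _].
      by under [X in _ - Rintegral _ _ X]eq_fun do rewrite t2 -mulrA.
    apply: eq_cvgn (cY _ (ctrig t).1.1 (ctrig t).1.2) => //.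
    by apply: eq_Rintegral => x _; rewrite mul1r.
  have [mu' cZ] : exists mu' : probability R R, forall f, Cb f ->
      (fun n => Rintegral P setT (fun w => f (Z n w))) @ \oo --> Rintegral mu' setT f.
    apply: laplace_continuity => // s sge0.
    by apply/cvg_ex; eexists; exact: (lap s sge0).
  have mu'1 := nonneg_law_of_cvg Z0 cZ.
  exists mu'; split; [split => // s sge0|].
    rewrite (Rintegral_nonneg_law mu'1 (mexp s)).
    apply: (cvg_unique _ (cZ _ (Cmax s sge0))) => //.
    apply: eq_cvgn (lap s sge0) => // n; congr Rintegral.
    by apply/funext => w; rewrite max_r.
  move=> f cf [M fM].
  have : Cb (fun x : R => f (2 * x)).
    split; last by exists M => x; exact: fM.
    move=> x; apply: (@continuous_comp _ _ _ (fun y : R => 2 * y) f); last exact: cf.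
    by apply: cvgMr; exact: cvg_id.
  move=> /cZ; apply: eq_cvgn => // n; congr Rintegral.
  by apply/funext => w; rewrite /Z /W mulrC divfK.
- have tW : tight_seq P W by exact: (cvg_law_tight mW cW).
  have tY : tight_seq P Y.
    exact: (tight_sum_of_tight_var mX indepX iX iX2 EX' EX2 s0 mN indepN d0 tW).
  (* The limit of [W n] is distributed as [2 x] with [x] of law [mu], so the halved exponent gives
     the Laplace transform of [mu] at [t^2]. *)
  have lexp t : (fun n => Rintegral P setT (fun w => expR (- (t ^+ 2 * W n w / 2)))) @ \oo -->
      (1 + `|t| `^ alpha) `^ (- nu).
    have t20 : 0 <= t ^+ 2 / 2 by rewrite divr_ge0 ?sqr_ge0.
    have -> : `|t| `^ alpha = (t ^+ 2) `^ (alpha / 2).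
      rewrite -(real_normK (num_real t)) -powR_mulrn// -powRrM; congr (_ `^ _).
      by field.
    rewrite -lawM ?sqr_ge0// (Rintegral_nonneg_law mu1 (mexp _)).
    apply: eq_cvgn (cW _ (Cmax _ t20).1 (Cmax _ t20).2).
      move=> n; congr Rintegral; apply/funext => w.
      by rewrite Wmax mulrAC.
    congr Rintegral; apply/funext => x; congr (expR (- _)).
    have -> : Num.max 0 (2 * x) = 2 * Num.max 0 x.
      by rewrite maxr_pMr// mulr0.
    by field.
  have ccos t : (fun n => Rintegral P setT (fun w => cos (t * Y n w))) @ \oo -->
      (1 + `|t| `^ alpha) `^ (- nu).
    apply: cvg_near_dist (lexp t) => e e0; have := trig tW t e e0.
    by apply: filterS => n [+ _]; rewrite distrC.
  have csin t : (fun n => Rintegral P setT (fun w => sin (t * Y n w))) @ \oo --> (0 : R).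
    apply/cvgrPdist_le => e e0; have := trig tW t e e0.
    by apply: filterS => n [_ +]; rewrite sub0r normrN.
  have [mu' cY] : exists mu' : probability R R, forall f, Cb f ->
      (fun n => Rintegral P setT (fun w => f (Y n w))) @ \oo --> Rintegral mu' setT f.
    by apply: levy_continuity => // t; apply/cvg_ex; eexists; [exact: ccos|exact: csin].
  exists mu'; split.
    move=> t; have [Cc Cs] := ctrig t.
    by split; [apply: (cvg_unique _ (cY _ Cc) (ccos t))|
      apply: (cvg_unique _ (cY _ Cs) (csin t))].
  move=> f cf bf; apply: eq_cvgn (cY f (conj cf bf)) => //.
  by apply: eq_Rintegral => x _; rewrite mul1r.
Qed.
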